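(* Let all the standing assumptions listed in the context hold, with step sequence $\gamma_k\asymp k^{-\theta}$. Let $\beta\in(0,1]$ and let $\varphi:\mathbb{R}^d\to\mathbb{R}$ satisfy $(\mathbf{T}_\beta)$. Suppose that there exists $\vartheta\in\mathcal{C}^{3,\beta}(\mathbb{R}^d,\mathbb{R})$ satisfying $(\mathbf{T}_\beta)$ such that $$\mathcal{A}\vartheta=|\sigma^*\nabla\varphi|^2-\nu\big(|\sigma^*\nabla\varphi|^2\big).$$ Then, for $\theta\in(\frac1{2+\beta},1]$, there exist explicit non-negative sequences $(c_n)_{n\ge1}$ and $(C_n)_{n\ge1}$, respectively increasing and decreasing for $n$ large enough, with $\lim_nC_n=\lim_nc_n=1$, such that for all $n\ge1$ and $a>0$ the following bound holds when $\frac{a}{\sqrt{\Gamma_n}}\to+\infty$ (the regime of ''super Gaussian deviations'', in which $a$ may depend on $n$): $$\mathbb{P}\big[\,|\sqrt{\Gamma_n}\,\nu_n(\mathcal{A}\varphi)|\ge a\big]\le2\,C_n\exp\Big(-c_n\frac{a^{4/3}\,\Gamma_n^{1/3}}{2\,\|\sigma\|_\infty^{2/3}\,[\vartheta]_1^{2/3}}\Big).$$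
   Context: **Notation.** $|\cdot|$ is the Euclidean norm; for a matrix $M$, $\|M\|=\mathrm{Tr}(MM^* )^{1/2}$ is the Frobenius norm; for a bounded vector- or matrix-valued map $\zeta$ on $\mathbb{R}^d$, $\|\zeta\|_\infty=\sup_x\|\zeta(x)\|$. $[g]_1=\sup_{x\ne x'}|g(x)-g(x')|/|x-x'|$ is the Lipschitz constant of $g$. For $u_n,v_n>0$, $u_n\asymp v_n$ means there are $n_0$ and $C\ge1$ with $C^{-1}v_n\le u_n\le Cv_n$ for $n\ge n_0$. For $k\ge0$ and $\beta\in(0,1]$, $\mathcal{C}^{k,\beta}(\mathbb{R}^d,\mathbb{R}^m)$ is the set of $k$-times continuously differentiable functions whose partial derivatives of orders $1,\dots,k$ are bounded and whose partial derivatives of order $k$ are (globally) $\beta$-Hölder continuous (the function itself need not be bounded). **Diffusion.** $b:\mathbb{R}^d\to\mathbb{R}^d$ and $\sigma:\mathbb{R}^d\to\mathbb{R}^d\otimes\mathbb{R}^r$ are Lipschitz continuous, $dY_t=b(Y_t)dt+\sigma(Y_t)dW_t$ with $W$ an $r$-dimensional Wiener process, $\Sigma=\sigma\sigma^*$, and the generator is $\mathcal{A}g(x)=b(x)\cdot\nabla g(x)+\frac12\mathrm{Tr}(\Sigma(x)D^2g(x))$. For a measure $m$ and a function $g$, $m(g)=\int g\,dm$. **Scheme.** $(\gamma_k)_{k\ge1}$ is a decreasing sequence of positive steps with $\gamma_k\asymp k^{-\theta}$, $\theta\in(0,1]$; $\Gamma_n=\sum_{k=1}^n\gamma_k$. For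 $n\ge0$, $$X_{n+1}=X_n+\gamma_{n+1}b(X_n)+\sqrt{\gamma_{n+1}}\,\sigma(X_n)U_{n+1},\qquad X_0\in L^2,$$ and the empirical measure is $\nu_n=\frac1{\Gamma_n}\sum_{k=1}^n\gamma_k\delta_{X_{k-1}}$. **Standing assumptions.** - (C1) There is $\lambda_0>0$ with $\mathbb{E}[\exp(\lambda|X_0|^2)]<\infty$ for all $\lambda<\lambda_0$. - (GC) $(U_n)_{n\ge1}$ are i.i.d. in $\mathbb{R}^r$, independent of $X_0$, $\mathbb{E}[U_1]=0$, $\mathbb{E}[U_1^iU_1^j]=\delta_{ij}$, $\mathbb{E}[U_1^iU_1^jU_1^k]=0$ for all $i,j,k$; and for every $1$-Lipschitz $g:\mathbb{R}^r\to\mathbb{R}$ and $\lambda>0$, $\mathbb{E}[\exp(\lambda g(U_1))]\le\exp(\lambda\mathbb{E}[g(U_1)]+\frac{\lambda^2}2)$. - (C2) $\sup_x\|\sigma(x)\|^2<\infty$. - ($\mathcal{L}_V$) There is $V:\mathbb{R}^d\to[v^*,+\infty)$, $v^*>0$, with: (i) $V\in\mathcal{C}^2$, $\|D^2V\|_\infty<\infty$, $V(x)\to\infty$ as $|x|\to\infty$; (ii) there is $C_V\in(0,\infty)$ with $|\nabla V|^2+|b|^2\le C_VV$ on $\mathbb{R}^d$; (iii) there are $\alpha_V>0$, $\beta_V\ge0$ with $\mathcal{A}V\le-\alpha_VV+\beta_V$ on $\mathbb{R}^d$. - (U) The diffusion has a unique invariant probability measure $\nu$. - (S) For all $k\ge1$,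 $\gamma_k\le\min\big(\frac1{2\sqrt{C_V\bar c}},\frac{\alpha_V}{2C_V\|D^2V\|_\infty}\big)$, where $K,\bar c>0$ are constants such that $|V(x)|\le\bar c|x|^2$ and $|b(x)|\le\sqrt{C_V\bar c}\,|x|$ for $|x|\ge K$ (such constants exist under ($\mathcal{L}_V$)). **Condition $(\mathbf{T}_\beta)$** for a function $g$: (i) $g\in\mathcal{C}^{3,\beta}(\mathbb{R}^d,\mathbb{R})$; (ii) $x\mapsto\langle b(x),\nabla g(x)\rangle$ is Lipschitz continuous; (iii) there is $C>0$ with $|g(x)|\le C(1+\sqrt{V(x)})$ for all $x$. *)

(* Defs.v *)
(* MathComp-Analysis, over an arbitrary [R : realType].
   Elements of R^d are column vectors ['cV[R]_d]. *)
From HB Require Import structures.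
From mathcomp Require Import all_boot all_order all_algebra.
From mathcomp Require Import all_classical all_reals all_analysis.

Set Implicit Arguments.
Unset Strict Implicit.
Unset Printing Implicit Defensive.

Import Order.TTheory GRing.Theory Num.Theory.
Import numFieldNormedType.Exports.

Local Open Scope classical_set_scope.
Local Open Scope ring_scope.

(* The library's norm on matrices is the max-entry norm; the Frobenius norm is
   needed here. On column vectors it is the Euclidean norm, and it is used for
   both. *)
Definition frob {R : realType} {m n : nat} (M : 'M[R]_(m, n)) : R :=
  Num.sqrt (\tr (M *m M^T)).

Definition dotp {R : realType} {d : nat} (x y : 'cV[R]_d) : R :=
  \sum_(i < d) x i 0 * y i 0.

Definition bounded_field {R : realType} {d m n : nat}
    (f : 'cV[R]_d -> 'M[R]_(m, n)) : Prop :=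
  has_ubound (range (fun x => frob (f x))).

(* Real supremum: it is the usual one for bounded [f], and 0 otherwise. *)
Definition supnorm {R : realType} {d m n : nat}
    (f : 'cV[R]_d -> 'M[R]_(m, n)) : R :=
  sup (range (fun x => frob (f x))).

(* The Lipschitz constant [g]_1; meaningful for Lipschitz [g]. *)
Definition lip_cst {R : realType} {d : nat} (g : 'cV[R]_d -> R) : R :=
  sup [set q | exists x y, x != y /\ q = `|g x - g y| / frob (x - y)].

Definition lipschitz_field {R : realType} {d m n : nat}
    (f : 'cV[R]_d -> 'M[R]_(m, n)) : Prop :=
  exists L : R, forall x y, frob (f x - f y) <= L * frob (x - y).

Definition lipschitz_fun {R : realType} {d : nat} (g : 'cV[R]_d -> R) : Prop :=
  exists L : R, forall x y, `|g x - g y| <= L * frob (x - y).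

(* [pderiv [:: i1; ...; ik] g] is d_i1 (... (d_ik g)). *)
Fixpoint pderiv {R : realType} {d : nat} (s : seq 'I_d) (g : 'cV[R]_d -> R)
    : 'cV[R]_d -> R :=
  if s is i :: s' then fun x => 'D_(delta_mx i 0) (pderiv s' g) x else g.

Definition class_C {R : realType} {d : nat} (k : nat) (g : 'cV[R]_d -> R)
    : Prop :=
  (forall (s : seq 'I_d) (i : 'I_d) (x : 'cV[R]_d), (size s < k)%N ->
     derivable (pderiv s g) x (delta_mx i 0)) /\
  (forall s : seq 'I_d, (size s <= k)%N -> continuous (pderiv s g)).

Definition class_C_holder {R : realType} {d : nat} (k : nat) (beta : R)
    (g : 'cV[R]_d -> R) : Prop :=
  [/\ class_C k g,
      forall s : seq 'I_d, (1 <= size s <= k)%N ->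
        exists M : R, forall x, `|pderiv s g x| <= M
    & forall s : seq 'I_d, size s = k ->
        exists L : R, forall x y,
          `|pderiv s g x - pderiv s g y| <= L * frob (x - y) `^ beta].

Definition grad {R : realType} {d : nat} (g : 'cV[R]_d -> R)
    (x : 'cV[R]_d) : 'cV[R]_d :=
  \col_i pderiv [:: i] g x.

Definition hess {R : realType} {d : nat} (g : 'cV[R]_d -> R)
    (x : 'cV[R]_d) : 'M[R]_d :=
  \matrix_(i, j) pderiv [:: i; j] g x.

Definition generator {R : realType} {d r : nat} (b : 'cV[R]_d -> 'cV[R]_d)
    (sigma : 'cV[R]_d -> 'M[R]_(d, r)) (g : 'cV[R]_d -> R) (x : 'cV[R]_d) : R :=
  dotp (b x) (grad g x) +
  2^-1 * \tr ((sigma x *m (sigma x)^T) *m hess g x).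

(* |sigma^* grad g|^2 *)
Definition carre_sigma {R : realType} {d r : nat}
    (sigma : 'cV[R]_d -> 'M[R]_(d, r)) (g : 'cV[R]_d -> R) (x : 'cV[R]_d) : R :=
  frob ((sigma x)^T *m grad g x) ^+ 2.

(* R^d with its Borel sigma-algebra, as a measurable type. *)
Definition borelV (R : realType) (d : nat) :=
  g_sigma_algebraType (@open 'cV[R]_d).

Definition borel_set {R : realType} {d : nat} (B : set 'cV[R]_d) : Prop :=
  <<s @open 'cV[R]_d >> B.

Section Diffusion.
Context {R : realType} {d r : nat} {dO : measure_display}
  {O : measurableType dO} (Q : probability O R).
Local Open Scope ereal_scope.

Definition filtration (F : R -> set (set O)) : Prop :=
  [/\ forall t : R, (0 <= t)%R -> sigma_algebra [set: O] (F t),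
      forall t : R, (0 <= t)%R -> F t `<=` measurable
    & forall s t : R, (0 <= s)%R -> (s <= t)%R -> F s `<=` F t].

Definition adapted {n : nat} (F : R -> set (set O)) (Y : R -> O -> 'cV[R]_n)
    : Prop :=
  forall (t : R) (B : set 'cV[R]_n), (0 <= t)%R -> borel_set B ->
    F t (Y t @^-1` B).

Definition continuous_paths {n : nat} (Y : R -> O -> 'cV[R]_n) : Prop :=
  forall w, {within `[0%R, +oo[, continuous (fun t : R => Y t w)}.

(* The last clause says at once that [W t - W s] is independent of [F s], that
   its coordinates are independent, and that each of them is N(0, t - s). *)
Definition wiener (F : R -> set (set O)) (W : R -> O -> 'cV[R]_r) : Prop :=
  [/\ adapted F W, continuous_paths W, forall w, W 0%R w = 0%R
    & forall (s t : R) (G : set O) (A : 'I_r -> set R),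
        (0 <= s)%R -> (s < t)%R -> F s G -> (forall i, measurable (A i)) ->
        Q (G `&` [set w | forall i, A i ((W t w - W s w)%R i 0%R)]) =
        Q G * \prod_(i < r) normal_prob 0%R (Num.sqrt (t - s)) (A i)].

Definition time_integral {n : nat} (f : R -> 'cV[R]_n) (t : R) : 'cV[R]_n :=
  \col_i (\int[lebesgue_measure]_(s in `[0%R, t]) f s i 0)%R.

Definition ito_sum (H : R -> O -> 'M[R]_(d, r)) (W : R -> O -> 'cV[R]_r)
    (t : R) (N : nat) (w : O) : 'cV[R]_d :=
  (\sum_(k < N) H (k%:R * (t / N%:R)) w *m
     (W (k.+1%:R * (t / N%:R)) w - W (k%:R * (t / N%:R)) w))%R.

(* For a continuous adapted integrand the Ito integral over [0, t] is the limit
   in probability of the left-endpoint Riemann sums over the subdivisions of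
   mesh t / N; this is how it is introduced here. *)
Definition is_ito_integral (H : R -> O -> 'M[R]_(d, r))
    (W : R -> O -> 'cV[R]_r) (t : R) (I : O -> 'cV[R]_d) : Prop :=
  forall e : R, (0 < e)%R ->
    Q [set w | (e <= frob (I w - ito_sum H W t N w))%R] @[N --> \oo] --> 0.

Definition sde_solution (b : 'cV[R]_d -> 'cV[R]_d)
    (sigma : 'cV[R]_d -> 'M[R]_(d, r)) (F : R -> set (set O))
    (W : R -> O -> 'cV[R]_r) (Y : R -> O -> 'cV[R]_d) : Prop :=
  [/\ filtration F, wiener F W, adapted F Y, continuous_paths Y
    & forall t : R, (0 <= t)%R ->
        is_ito_integral (fun s w => sigma (Y s w)) W t
          (fun w => Y t w - Y 0 w - time_integral (fun s => b (Y s w)) t)%R].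

End Diffusion.

Definition invariant {R : realType} {d r : nat} (b : 'cV[R]_d -> 'cV[R]_d)
    (sigma : 'cV[R]_d -> 'M[R]_(d, r)) (nu : probability (borelV R d) R)
    : Prop :=
  forall (dO : measure_display) (O : measurableType dO) (Q : probability O R)
    (F : R -> set (set O)) (W : R -> O -> 'cV[R]_r) (Y : R -> O -> 'cV[R]_d),
    sde_solution Q b sigma F W Y ->
    (forall B, borel_set B -> Q (Y 0 @^-1` B) = nu B) ->
    forall t : R, 0 <= t -> forall B, borel_set B -> Q (Y t @^-1` B) = nu B.

Definition unique_invariant {R : realType} {d r : nat}
    (b : 'cV[R]_d -> 'cV[R]_d) (sigma : 'cV[R]_d -> 'M[R]_(d, r))
    (nu : probability (borelV R d) R) : Prop :=
  invariant b sigma nu /\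
  forall nu' : probability (borelV R d) R, invariant b sigma nu' ->
    forall B, borel_set B -> nu' B = nu B.

Definition asymp {R : realType} (u v : nat -> R) : Prop :=
  exists (n0 : nat) (C : R), 1 <= C /\
    forall n, (n0 <= n)%N -> C^-1 * v n <= u n <= C * v n.

(* Sequences indexed by k >= 1 are functions on [nat] whose value at 0 is never
   used. *)
Definition step_sequence {R : realType} (theta : R) (gamma : nat -> R)
    : Prop :=
  [/\ forall k, (0 < k)%N -> 0 < gamma k,
      forall k, (0 < k)%N -> gamma k.+1 <= gamma k
    & asymp gamma (fun k => k%:R `^ (- theta))].

Definition Gamma_sum {R : realType} (gamma : nat -> R) (n : nat) : R :=
  \sum_(1 <= k < n.+1) gamma k.

Fixpoint scheme {R : realType} {d r : nat} {T : Type}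
    (b : 'cV[R]_d -> 'cV[R]_d) (sigma : 'cV[R]_d -> 'M[R]_(d, r))
    (gamma : nat -> R) (X0 : T -> 'cV[R]_d) (U : nat -> T -> 'cV[R]_r)
    (n : nat) (w : T) : 'cV[R]_d :=
  if n is m.+1 then
    let x := scheme b sigma gamma X0 U m w in
    x + gamma m.+1 *: b x + Num.sqrt (gamma m.+1) *: (sigma x *m U m.+1 w)
  else X0 w.

(* nu_n(g), the integral of g against the empirical measure
   Gamma_n^-1 sum_k gamma_k dirac_(X_(k-1)). *)
Definition emp_mean {R : realType} {d : nat} {T : Type} (gamma : nat -> R)
    (X : nat -> T -> 'cV[R]_d) (n : nat) (g : 'cV[R]_d -> R) (w : T) : R :=
  (Gamma_sum gamma n)^-1 * \sum_(1 <= k < n.+1) gamma k * g (X k.-1 w).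

Section Noise.
Context {R : realType} {d r : nat} {dO : measure_display}
  {O : measurableType dO} (P : probability O R).
Local Open Scope ereal_scope.

Definition random_vector {n : nat} (X : O -> 'cV[R]_n) : Prop :=
  forall B, borel_set B -> measurable (X @^-1` B).

Definition square_integrable {n : nat} (X : O -> 'cV[R]_n) : Prop :=
  'E_P[fun w => (frob (X w) ^+ 2)%R] < +oo.

Definition exp_square_moment (lambda0 : R) (X0 : O -> 'cV[R]_d) : Prop :=
  forall lambda : R, (lambda < lambda0)%R ->
    'E_P[fun w => expR (lambda * frob (X0 w) ^+ 2)] < +oo.

(* X0, U_1, U_2, ... are mutually independent and the U_k have the same law. *)
Definition iid_noise (X0 : O -> 'cV[R]_d) (U : nat -> O -> 'cV[R]_r)
    : Prop :=
  (forall (n : nat) (A : set 'cV[R]_d) (B : nat -> set 'cV[R]_r),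
     borel_set A -> (forall k, borel_set (B k)) ->
     P (X0 @^-1` A `&` \bigcap_(k in [set k | (1 <= k <= n)%N]) U k @^-1` B k) =
     P (X0 @^-1` A) * \prod_(1 <= k < n.+1) P (U k @^-1` B k)) /\
  (forall (k : nat) (B : set 'cV[R]_r), (0 < k)%N -> borel_set B ->
     P (U k @^-1` B) = P (U 1%N @^-1` B)).

(* An extended-real expectation equal to a real number forces integrability,
   so the moment identities contain the existence of the moments. *)
Definition gaussian_concentration (X0 : O -> 'cV[R]_d)
    (U : nat -> O -> 'cV[R]_r) : Prop :=
  [/\ iid_noise X0 U,
      forall i, 'E_P[fun w => U 1%N w i 0%R] = 0,
      forall i j, 'E_P[fun w => (U 1%N w i 0 * U 1%N w j 0)%R] = (i == j)%:R%:E,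
      forall i j k,
        'E_P[fun w => (U 1%N w i 0 * U 1%N w j 0 * U 1%N w k 0)%R] = 0
    & forall (g : 'cV[R]_r -> R) (lambda : R),
        (forall x y, (`|g x - g y| <= frob (x - y))%R) -> (0 < lambda)%R ->
        'E_P[fun w => expR (lambda * g (U 1%N w))] <=
        (expR (lambda * fine ('E_P[fun w => g (U 1%N w)])
               + lambda ^+ 2 / 2))%:E].

End Noise.

(* All the data of the Lyapunov condition are explicit because the step
   condition below refers to them. *)
Definition lyapunov {R : realType} {d r : nat} (b : 'cV[R]_d -> 'cV[R]_d)
    (sigma : 'cV[R]_d -> 'M[R]_(d, r)) (V : 'cV[R]_d -> R)
    (vstar CV alphaV betaV : R) : Prop :=
  [/\ [/\ 0 < vstar & forall x, vstar <= V x],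
      [/\ class_C 2 V, bounded_field (hess V)
        & forall M : R, exists K : R, forall x, K <= frob x -> M <= V x],
      0 < CV /\
      (forall x, frob (grad V x) ^+ 2 + frob (b x) ^+ 2 <= CV * V x)
    & [/\ 0 < alphaV, 0 <= betaV
        & forall x, generator b sigma V x <= - alphaV * V x + betaV]].

Definition small_steps {R : realType} {d : nat} (b : 'cV[R]_d -> 'cV[R]_d)
    (V : 'cV[R]_d -> R) (CV alphaV K cbar : R) (gamma : nat -> R) : Prop :=
  [/\ 0 < K, 0 < cbar,
      forall x, K <= frob x ->
        `|V x| <= cbar * frob x ^+ 2 /\
        frob (b x) <= Num.sqrt (CV * cbar) * frob x
    & forall k, (0 < k)%N ->
        gamma k <= Num.min (1 / (2 * Num.sqrt (CV * cbar)))
                           (alphaV / (2 * CV * supnorm (hess V)))].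

Definition T_beta {R : realType} {d : nat} (b : 'cV[R]_d -> 'cV[R]_d)
    (V : 'cV[R]_d -> R) (beta : R) (g : 'cV[R]_d -> R) : Prop :=
  [/\ class_C_holder 3 beta g,
      lipschitz_fun (fun x => dotp (b x) (grad g x))
    & exists C : R, 0 < C /\ forall x, `|g x| <= C * (1 + Num.sqrt (V x))].

(* Main.v *)
(* In terms of u = a / sqrt(Gamma_n) the claim reads
   P(|nu_n(A phi)| >= u) <= 2 C_n exp(- c_n Gamma_n u^(4/3) / D), with D the
   constant of the theorem, and it is only required for large u. The
   non-sharp Gaussian bound exp(- kappa Gamma_n u^2) is then already stronger,
   for any kappa > 0, so c_n = C_n = 1 works.
   The Gaussian bound holds because |A phi| <= M sqrt(V): the first derivatives
   of phi, its second derivatives and sigma are bounded, and |b|^2 <= C_V V.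
   The function sqrt(V) is Lipschitz and is itself a Lyapunov function, so by
   (GC) the quantity
   exp(lambda (alpha/4 sum_(k <= n) gamma_k sqrt(V(X_(k-1))) + sqrt(V(X_n))))
   grows in expectation at most by the factor exp(K lambda^2 gamma_(n+1)) at
   each step. Chernoff's inequality with lambda proportional to u concludes. *)
Require Import Defs.
From HB Require Import structures.
From mathcomp Require Import all_boot all_order all_algebra.
From mathcomp Require Import all_classical all_reals all_analysis.
From mathcomp Require Import measurable_realfun ring lra.

Set Implicit Arguments.
Unset Strict Implicit.
Unset Printing Implicit Defensive.

Import Order.TTheory GRing.Theory Num.Theory.
Import numFieldNormedType.Exports.

Local Open Scope classical_set_scope.
Local Open Scope ring_scope.

(** The square root is forced by (GC): it controls exponentials of Lipschitz functions of the noise,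
    for every [lambda], whereas [V] may grow quadratically. Once concentration has paid the variance
    term, only an upper bound on the mean of sqrt(V) after a step is missing. The rate [alphaV] is
    halved by the step condition and halved again by the square root, hence the weight [alphaV / 4].
    All moment bounds are stated for [lambda >= 1], so that terms constant or linear in [lambda] are
    absorbed into [lambda ^+ 2]; this is where large u enters. The initial law contributes a factor
    exp(K0 lambda^2), absorbed in the same form because Gamma_n >= gamma_1. The resulting threshold
    on u is therefore uniform in n and a. Conditioning on the past is replaced by freezing: the
    sample space with the sigma-algebra of the past is itself a random element, independent of the
    next noise, and Tonelli's theorem integrates the noise alone. *)

(** * Frobenius norm and inner product *)

Section Euclid.
Context {R : realType}.

(** Lagrange's identity: the double sum of the squared 2 x 2 minors is twice the gap between the two
    sides. *)
Lemma cauchy_schwarz_sum (I : finType) (f g : I -> R) :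
  (\sum_i f i * g i) ^+ 2 <= (\sum_i f i ^+ 2) * (\sum_i g i ^+ 2).
Proof.
have : 0 <= \sum_i \sum_j (f i * g j - f j * g i) ^+ 2.
  by do 2 (apply: sumr_ge0 => ? _); exact: sqr_ge0.
have E : \sum_i \sum_j (f i * g j - f j * g i) ^+ 2 =
    2 * ((\sum_i f i ^+ 2) * (\sum_i g i ^+ 2) - (\sum_i f i * g i) ^+ 2).
  have -> : (\sum_i f i ^+ 2) * (\sum_i g i ^+ 2) =
      \sum_i \sum_j f i ^+ 2 * g j ^+ 2.
    by rewrite mulr_suml; apply: eq_bigr => i _; rewrite mulr_sumr.
  have E2 : \sum_i \sum_j f i ^+ 2 * g j ^+ 2 = \sum_i \sum_j f j ^+ 2 * g i ^+ 2.
    by rewrite exchange_big.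
  rewrite mulrBr mulr_natl mulr2n {2}E2 expr2 mulr_suml mulr_sumr -big_split -sumrB.
  apply: eq_bigr => i _; rewrite !mulr_sumr -big_split -sumrB.
  by apply: eq_bigr => j _ /=; ring.
by rewrite E pmulr_rge0 ?subr_ge0// ltr0n.
Qed.

Lemma frob_ge0 m n (M : 'M[R]_(m, n)) : 0 <= frob M.
Proof. exact: sqrtr_ge0. Qed.

Lemma frob_sqr m n (M : 'M[R]_(m, n)) :
  frob M ^+ 2 = \sum_i \sum_j M i j ^+ 2.
Proof.
have E : \tr (M *m M^T) = \sum_i \sum_j M i j ^+ 2.
  by apply: eq_bigr => i _; rewrite mxE; apply: eq_bigr => j _; rewrite mxE.
rewrite /frob sqr_sqrtr// E.
by do 2 (apply: sumr_ge0 => ? _); exact: sqr_ge0.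
Qed.

Lemma frob_sqr_col n (x : 'cV[R]_n) : frob x ^+ 2 = \sum_i x i 0 ^+ 2.
Proof. by rewrite frob_sqr; apply: eq_bigr => i _; rewrite big_ord1. Qed.

Lemma frob_sqr_pair m n (M : 'M[R]_(m, n)) :
  frob M ^+ 2 = \sum_(p : 'I_m * 'I_n) M p.1 p.2 ^+ 2.
Proof. by rewrite frob_sqr pair_bigA. Qed.

Lemma le_of_sqr (x y : R) : 0 <= y -> x ^+ 2 <= y ^+ 2 -> `|x| <= y.
Proof.
by move=> y0; rewrite -[x ^+ 2]real_normK ?num_real// ler_pXn2r ?nnegrE.
Qed.

Lemma entry_le_frob m n (M : 'M[R]_(m, n)) i j : `|M i j| <= frob M.
Proof.
apply: le_of_sqr; first exact: frob_ge0.
rewrite frob_sqr_pair (bigD1 (i, j))//= lerDl.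
by apply: sumr_ge0 => ? _; exact: sqr_ge0.
Qed.

Lemma frob_le_bound m n (M : 'M[R]_(m, n)) (B : R) :
  (forall i j, `|M i j| <= B) -> frob M <= Num.sqrt (m%:R * n%:R) * B.
Proof.
(* A negative [B] is possible only for an empty matrix, where both sides vanish. *)
move=> MB; case: (leP 0 B) => [B0|B0]; last first.
  case: m M MB => [|m] M MB.
    rewrite mul0r sqrtr0 mul0r /frob /mxtrace big_ord0 sqrtr0//.
  case: n M MB => [|n] M MB; last first.
    by have := le_lt_trans (MB 0 0) B0; rewrite normr_lt0.
  by rewrite mulr0 sqrtr0 mul0r /frob /mxtrace big1 ?sqrtr0// => i _; rewrite mxE big_ord0.
rewrite -[leLHS]ger0_norm ?frob_ge0//; apply: le_of_sqr.
  by rewrite mulr_ge0// sqrtr_ge0.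
rewrite frob_sqr exprMn sqr_sqrtr ?mulr_ge0//.
have -> : m%:R * n%:R * B ^+ 2 = \sum_(i < m) \sum_(j < n) B ^+ 2.
  by rewrite !sumr_const !card_ord -mulrnA -[RHS]mulr_natl natrM mulrC (mulrC n%:R) mulrC.
apply: ler_sum => i _; apply: ler_sum => j _.
by rewrite -(real_normK (num_real (M i j))) ler_pXn2r ?nnegrE.
Qed.

Lemma frob_mulmx m n p (A : 'M[R]_(m, n)) (B : 'M[R]_(n, p)) :
  frob (A *m B) <= frob A * frob B.
Proof.
rewrite -[leLHS]ger0_norm ?frob_ge0//; apply: le_of_sqr.
  by rewrite mulr_ge0 ?frob_ge0.
rewrite exprMn !frob_sqr mulr_suml; apply: ler_sum => i _.
rewrite [X in _ * X]exchange_big mulr_sumr; apply: ler_sum => j _.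
by rewrite mxE cauchy_schwarz_sum.
Qed.

Lemma frob_tr m n (A : 'M[R]_(m, n)) : frob A^T = frob A.
Proof. by rewrite /frob trmxK mxtrace_mulC. Qed.

Lemma mxtrace_mul_le m n (A : 'M[R]_(m, n)) (B : 'M[R]_(n, m)) :
  `|\tr (A *m B)| <= frob A * frob B.
Proof.
apply: le_of_sqr; first by rewrite mulr_ge0 ?frob_ge0.
have -> : \tr (A *m B) = \sum_(p : 'I_m * 'I_n) A p.1 p.2 * B^T p.1 p.2.
  rewrite -(pair_bigA _ (fun i j => A i j * B^T i j)) /=.
  by apply: eq_bigr => i _; rewrite mxE; apply: eq_bigr => j _; rewrite mxE.
by rewrite exprMn -(frob_tr B) !frob_sqr_pair cauchy_schwarz_sum.
Qed.

Lemma dotpE n (x y : 'cV[R]_n) : dotp x y = \tr (x^T *m y).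
Proof.
by rewrite /mxtrace big_ord1 mxE; apply: eq_bigr => i _; rewrite mxE.
Qed.

Lemma dotp_le n (x y : 'cV[R]_n) : `|dotp x y| <= frob x * frob y.
Proof. by rewrite dotpE -(frob_tr x) mxtrace_mul_le. Qed.

Lemma dotpDr n (x y z : 'cV[R]_n) : dotp x (y + z) = dotp x y + dotp x z.
Proof. by rewrite !dotpE mulmxDr linearD. Qed.

Lemma dotpZr n (x y : 'cV[R]_n) a : dotp x (a *: y) = a * dotp x y.
Proof. by rewrite !dotpE -scalemxAr linearZ. Qed.

Lemma dotpC n (x y : 'cV[R]_n) : dotp x y = dotp y x.
Proof. by apply: eq_bigr => i _; rewrite mulrC. Qed.

Lemma frob_sqr_dotp n (x : 'cV[R]_n) : frob x ^+ 2 = dotp x x.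
Proof. by rewrite frob_sqr_col; apply: eq_bigr => i _; rewrite expr2. Qed.

Lemma frobZ m n (a : R) (A : 'M[R]_(m, n)) : frob (a *: A) = `|a| * frob A.
Proof.
have -> : frob (a *: A) = Num.sqrt (a ^+ 2 * \tr (A *m A^T)).
  by rewrite /frob linearZ /= -scalemxAl -scalemxAr !linearZ/= mulrA -expr2.
by rewrite sqrtrM ?sqr_ge0// sqrtr_sqr.
Qed.

Lemma mx_norm_le m n (M : 'M[R]_(m, n)) (B : R) : 0 <= B ->
  (forall i j, `|M i j| <= B) -> `|M| <= B.
Proof.
move=> B0 MB; rewrite [leLHS]/Num.norm/= mx_normrE.
by apply/bigmax_leP; split=> // -[i j] _; exact: MB.
Qed.

Lemma entry_le_mx_norm m n (M : 'M[R]_(m, n)) i j : `|M i j| <= `|M|.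
Proof.
rewrite [leRHS]/Num.norm/= mx_normrE; apply/bigmax_geP; right.
by exists (i, j).
Qed.

End Euclid.

(** * Differential calculus from partial derivatives *)

Section Calculus.
Context {R : realType} {d : nat}.
Implicit Types (g : 'cV[R]_d -> R) (x y h : 'cV[R]_d).

Local Notation e_ i := (delta_mx i 0 : 'cV[R]_d).

Lemma is_derive_coord_line g (i : 'I_d) x (t : R) :
  derivable g (x + t *: e_ i) (e_ i) ->
  is_derive t 1 (fun s : R => g (x + s *: e_ i)) ('D_(e_ i) g (x + t *: e_ i)).
Proof.
move=> dg.
have E : (fun k : R => k^-1 *: (((fun s : R => g (x + s *: e_ i)) \o shift t)
             (k *: (1 : R)) - g (x + t *: e_ i))) =
         (fun k : R => k^-1 *: ((g \o shift (x + t *: e_ i)) (k *: e_ i)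
             - g (x + t *: e_ i))).
  apply/funext => k /=; congr (_ *: (g _ - _)).
  by rewrite [k *: (1 : R)]mulr1 scalerDl addrCA.
apply: DeriveDef.
  by rewrite /derivable E.
by rewrite /derive E.
Qed.

Lemma MVT_is_derive (f df : R -> R) (a b : R) : a <= b ->
  (forall t : R, is_derive t (1 : R) f (df t)) ->
  exists2 c, c \in `[a, b]%R & f b - f a = df c * (b - a).
Proof.
move=> ab fD; apply: MVT_segment => //.
apply: continuous_subspaceT => t.
by apply: differentiable_continuous; apply/derivable1_diffP; have [] := fD t.
Qed.

Let trunc h n : 'cV[R]_d := \col_i (if (i < n)%N then h i 0 else 0).

Let truncS h (n : 'I_d) : trunc h n.+1 = trunc h n + h n 0 *: e_ n.
Proof.
apply/matrixP => i j; rewrite !mxE ord1 eqxx andbT ltnS leq_eqVlt.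
have [->|ne] := eqVneq i n; first by rewrite eqxx ltnn mulr1 add0r.
by rewrite (negbTE (_ : nat_of_ord i != n)) ?(inj_eq val_inj)// mulr0 addr0.
Qed.

(** The path from [x] to [x + h] moves one coordinate at a time through the points [x + trunc h n];
    on each segment the one-dimensional mean value theorem applies. *)
Lemma telescoped_increment_le g x h (c : 'I_d -> R) (eps : R) :
  (forall i z, derivable g z (e_ i)) ->
  (forall i z, `|z - x| <= `|h| -> `|'D_(e_ i) g z - c i| <= eps) ->
  `|g (x + h) - g x - \sum_i h i 0 * c i| <= eps * \sum_i `|h i 0|.
Proof.
move=> dg cE.
suff H n : (n <= d)%N ->
    `|g (x + trunc h n) - g x - \sum_(i < d | (i < n)%N) h i 0 * c i| <=
    eps * \sum_(i < d | (i < n)%N) `|h i 0|.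
  have := H d (leqnn d).
  have -> : trunc h d = h by apply/matrixP => i j; rewrite !mxE ltn_ord ord1.
  have allT (F : 'I_d -> R) : \sum_(i < d | (i < d)%N) F i = \sum_i F i.
    by apply: eq_bigl => i; rewrite ltn_ord.
  by rewrite !allT.
elim: n => [_|n IH nd].
  have -> : trunc h 0 = 0 by apply/matrixP => i j; rewrite !mxE.
  by rewrite addr0 subrr !big_pred0 ?subr0 ?normr0 ?mulr0.
have := IH (ltnW nd); pose i0 := Ordinal nd.
have big_step (F : 'I_d -> R) :
    \sum_(i < d | (i < n.+1)%N) F i = F i0 + \sum_(i < d | (i < n)%N) F i.
  rewrite (bigD1 i0)//=; congr (_ + _); apply: eq_bigl => i.
  by rewrite ltnS [RHS]ltn_neqAle andbC.
rewrite !big_step (truncS h i0) /=.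
set y := x + trunc h n; move=> {}IH.
have [xi xiB gE] : exists2 xi, `|xi| <= `|h i0 0| &
    g (y + h i0 0 *: e_ i0) - g y = h i0 0 * 'D_(e_ i0) g (y + xi *: e_ i0).
  have dF (s : R) : is_derive s 1 (fun s : R => g (y + s *: e_ i0))
      ('D_(e_ i0) g (y + s *: e_ i0)).
    exact: is_derive_coord_line.
  have [k0|k0] := leP 0 (h i0 0).
    have [xi] := MVT_is_derive k0 dF.
    rewrite in_itv/= scale0r addr0 subr0 mulrC => /andP[xi0 xih] ->.
    by exists xi => //; rewrite !ger0_norm.
  have [xi] := MVT_is_derive (ltW k0) dF.
  rewrite in_itv/= scale0r addr0 sub0r mulrC mulNr => /andP[xi0 xih] E.
  exists xi; first by rewrite !ler0_norm ?lerN2// ltW.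
  by rewrite -[LHS]opprB E opprK.
rewrite addrA -/y.
have : `|'D_(e_ i0) g (y + xi *: e_ i0) - c i0| <= eps.
  apply: cE.
  (* In the max-entry norm every point of the broken path stays within [|h|] of [x], so the
     hypothesis on the partial derivatives applies there. *)
  have -> : y + xi *: e_ i0 - x = trunc h n + xi *: e_ i0.
    by rewrite /y -[x + _ + _]addrA addrAC subrr add0r.
  have hle k : `|h k 0| <= `|h| by exact: entry_le_mx_norm.
  apply: mx_norm_le => [|i j]; first exact: normr_ge0.
  rewrite !mxE ord1 eqxx andbT; have [->|ne] := eqVneq i i0.
    by rewrite ltnn mulr1 add0r (le_trans xiB)// hle.
  rewrite mulr0 addr0; case: ifP => _; first exact: hle.
  by rewrite normr0 (le_trans _ (hle i)).
move=> cE0.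
have -> : g (y + h i0 0 *: e_ i0) - g x -
    (h i0 0 * c i0 + \sum_(i < d | (i < n)%N) h i 0 * c i) =
    h i0 0 * ('D_(e_ i0) g (y + xi *: e_ i0) - c i0) +
    (g y - g x - \sum_(i < d | (i < n)%N) h i 0 * c i).
  by rewrite mulrBr -gE; ring.
apply: (le_trans (ler_normD _ _)); rewrite [leRHS]mulrDr lerD// normrM mulrC.
by rewrite ler_wpM2r.
Qed.

(** [class_C] speaks only of derivatives along basis vectors. Continuity of the partial derivatives
    makes them nearly constant close to [y], and the telescoped increment then gives the derivative
    along an arbitrary [h]. *)
Lemma is_derive_line g x h (t : R) :
  (forall i z, derivable g z (e_ i)) ->
  (forall i, continuous (pderiv [:: i] g)) ->
  is_derive t 1 (fun s : R => g (x + s *: h)) (dotp (grad g (x + t *: h)) h).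
Proof.
move=> dg cg; set y : 'cV[R]_d := x + t *: h; set D := dotp _ _.
have key : (fun k : R => k^-1 *: (((fun s : R => g (x + s *: h)) \o shift t)
             (k *: (1 : R)) - g y)) @ 0^' --> D.
  have -> : (fun k : R => k^-1 *: (((fun s : R => g (x + s *: h)) \o shift t)
      (k *: (1 : R)) - g y)) = (fun k : R => k^-1 * (g (y + k *: h) - g y)).
    apply/funext => k /=; congr (_ * (g _ - _)).
    by rewrite [k *: (1 : R)]mulr1 scalerDl addrCA addrC.
  apply/cvgrPdist_le => /= e e0.
  pose N := 1 + \sum_i `|h i 0|.
  have N0 : 0 < N by rewrite ltr_wpDr// sumr_ge0.
  have eN0 : 0 < e / N by rewrite divr_gt0.
  have cgy i : nbhs y [set z | `|'D_(e_ i) g z - 'D_(e_ i) g y| <= e / N].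
    have /cvgrPdist_le/(_ _ eN0) := cg i y.
    by apply: filterS => z /=; rewrite distrC.
  have := @filter_forall _ _ _ (nbhs y) (nbhs_filter y) cgy.
  move=> /nbhs_ballP[del /= del0 Hdel].
  have hn0 : 0 < 1 + `|h| by rewrite ltr_wpDr.
  near=> k.
  have k0 : k != 0 by near: k; exact: nbhs_dnbhs_neq.
  have kdel : `|k| * (1 + `|h|) < del.
    rewrite -ltr_pdivlMr//; near: k; apply: dnbhs0_lt; exact: divr_gt0.
  have : `|g (y + k *: h) - g y - \sum_i (k *: h) i 0 * 'D_(e_ i) g y| <=
      e / N * \sum_i `|(k *: h) i 0|.
    apply: telescoped_increment_le => // i z zy; apply: Hdel.
    rewrite -ball_normE/= distrC; apply: le_lt_trans zy _.
    rewrite normrZ; apply: le_lt_trans kdel.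
    by rewrite ler_wpM2l// lerDr.
  have -> : \sum_i (k *: h) i 0 * 'D_(e_ i) g y = k * D.
    rewrite /D /dotp mulr_sumr; apply: eq_bigr => i _.
    by rewrite !mxE /= -mulrA [h i 0 * _]mulrC.
  have -> : \sum_i `|(k *: h) i 0| = `|k| * \sum_i `|h i 0|.
    by rewrite mulr_sumr; apply: eq_bigr => i _; rewrite mxE normrM.
  move=> H; rewrite distrC.
  have -> : k^-1 * (g (y + k *: h) - g y) - D = k^-1 * (g (y + k *: h) - g y - k * D).
    by rewrite [RHS]mulrBr mulKf.
  rewrite normrM normfV ler_pdivrMl ?normr_gt0//.
  apply: le_trans H _; rewrite mulrCA ler_wpM2l// -mulrA ger_pMr//.
  by rewrite ler_pdivrMl// mulr1 lerDr.
apply: DeriveDef; first by apply/cvg_ex; exists D.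
by apply: cvg_lim.
Unshelve. all: by end_near. Qed.

Lemma class_C_le k l g : (k <= l)%N -> class_C l g -> class_C k g.
Proof.
move=> kl [dg cg]; split=> [s i x sk|s sk]; first exact/dg/(leq_trans sk).
exact/cg/(leq_trans sk).
Qed.

Lemma class_C1_derivable k g : class_C k.+1 g -> forall i z, derivable g z (e_ i).
Proof. by move=> [H _] i z; exact: (H [::] i z). Qed.

Lemma class_C1_continuous k g : class_C k.+1 g -> forall i, continuous (pderiv [:: i] g).
Proof. by move=> [_ H] i; exact: H. Qed.

Lemma class_C_continuous k g : class_C k g -> continuous g.
Proof. by move=> [_ H]; exact: (H [::]). Qed.

Lemma class_C_line k g x h (t : R) : class_C k.+1 g ->
  is_derive t 1 (fun s : R => g (x + s *: h)) (dotp (grad g (x + t *: h)) h).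
Proof.
by move=> gC; apply: is_derive_line; [exact: class_C1_derivable gC|exact: class_C1_continuous gC].
Qed.

(** The mean value theorem is used twice along the segment, for the value and then for the slope.
    This gives [H] where Taylor's formula gives half of it, which affects constants only. *)
Lemma second_order_bound g (H : R) x h : class_C 2 g ->
  (forall z, frob (hess g z) <= H) ->
  g (x + h) <= g x + dotp (grad g x) h + H * frob h ^+ 2.
Proof.
move=> gC gH.
have [c cI E] := MVT_is_derive ler01 (fun t => class_C_line x h t gC).
move: E; rewrite scale1r scale0r addr0 subr0 mulr1 => E.
rewrite -[g (x + h)](subrK (g x)) E addrC -addrA lerD2l.
move: cI; rewrite in_itv/= => /andP[c0 c1].
pose G (t : R) := dotp (grad g (x + t *: h)) h.
have GD (t : R) : is_derive t (1 : R) G (dotp (hess g (x + t *: h) *m h) h).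
  have -> : G = \sum_i (fun t : R => h i 0 *: pderiv [:: i] g (x + t *: h)).
    by apply/funext => s; rewrite fct_sumE /G /dotp; apply: eq_bigr => i _; rewrite mxE mulrC.
  (* Exchanging the two sums matches the order of differentiation on both sides, so no symmetry of
     the second derivatives is invoked. *)
  have -> : dotp (hess g (x + t *: h) *m h) h =
      \sum_i h i 0 *: dotp (grad (pderiv [:: i] g) (x + t *: h)) h.
    rewrite /dotp; under eq_bigr do rewrite mxE mulr_suml.
    rewrite exchange_big; apply: eq_bigr => i _ /=.
    rewrite [RHS]mulr_sumr; apply: eq_bigr => j _; rewrite !mxE /=; ring.
  have Di i : is_derive t (1 : R) (fun s : R => pderiv [:: i] g (x + s *: h))
      (dotp (grad (pderiv [:: i] g) (x + t *: h)) h).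
    apply: is_derive_line => [j z|j]; first by apply: (gC.1 [:: i]).
    exact: (gC.2 [:: j; i]).
  apply: is_derive_sum => i; exact: is_deriveZ.
have [c' _ E'] := MVT_is_derive c0 GD.
have -> : dotp (grad g (x + c *: h)) h = dotp (grad g x) h + (G c - G 0).
  by rewrite /G scale0r addr0; ring.
rewrite lerD2l E' subr0.
apply: (@le_trans _ _ (frob (hess g (x + c' *: h)) * frob h ^+ 2 * c)).
  rewrite ler_wpM2r// (le_trans (ler_norm _))// (le_trans (dotp_le _ _))//.
  by rewrite expr2 mulrA ler_wpM2r ?frob_ge0// frob_mulmx.
rewrite (le_trans (_ : _ <= H * frob h ^+ 2 * c)) //.
  by rewrite ler_wpM2r// ler_wpM2r// sqr_ge0.
have H0 : 0 <= H by rewrite (le_trans (frob_ge0 _) (gH x)).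
by rewrite ler_piMr// mulr_ge0// sqr_ge0.
Qed.

(** The gradient of the square root of [g] is that of [g] divided by [2 * Num.sqrt (g z)], hence
    bounded under the assumed growth. *)
Lemma sqrt_lipschitz g (C : R) x y : 0 <= C -> class_C 1 g ->
  (forall z, 0 < g z) -> (forall z, frob (grad g z) ^+ 2 <= C * g z) ->
  `|Num.sqrt (g x) - Num.sqrt (g y)| <= Num.sqrt C * frob (x - y).
Proof.
move=> C0 gC g0 gradg; pose h := x - y.
pose dF (t : R) := (2 * Num.sqrt (g (y + t *: h)))^-1 * dotp (grad g (y + t *: h)) h.
have FD (t : R) : is_derive t (1 : R) (Num.sqrt \o (fun s : R => g (y + s *: h))) (dF t).
  exact: (@is_derive1_comp _ _ _ _ _ _ (is_derive1_sqrt (g0 _)) (class_C_line _ _ _ gC)).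
have [c _] := MVT_is_derive ler01 FD.
have yh : y + h = x by rewrite /h addrC subrK.
rewrite /= scale1r scale0r addr0 subr0 mulr1 yh -/h => ->.
have s0 z : 0 < Num.sqrt (g z) by rewrite sqrtr_gt0.
have s2 z : 0 < 2 * Num.sqrt (g z) by rewrite mulr_gt0.
rewrite /dF normrM normfV [`|2 * _|]gtr0_norm// ler_pdivrMl//.
apply: (le_trans (dotp_le _ _)); rewrite mulrA ler_wpM2r ?frob_ge0//.
apply: (@le_trans _ _ (Num.sqrt C * Num.sqrt (g (y + c *: h)))).
  rewrite -sqrtrM// -[leLHS]ger0_norm ?frob_ge0// -sqrtr_sqr ler_wsqrtr//.
by rewrite mulrAC -mulrA ler_peMl ?mulr_ge0 ?sqrtr_ge0// ler1n.
Qed.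

End Calculus.

(** * Borel measurability of vectors and of the scheme *)

Section Measurability.
Context {R : realType}.

Lemma measurable_coord d i : measurable_fun [set: borelV R d]
  (fun x : borelV R d => (x : 'cV[R]_d) i 0).
Proof.
apply: (measurability _ (RGenOpens.measurableE R)) => _ [_ [a [c ->] <-]].
rewrite setTI; apply: sub_sigma_algebra.
by apply: open_comp => [x _|]; [exact: coord_continuous|exact: interval_open].
Qed.

Lemma continuous_measurable_borelV d (g : 'cV[R]_d -> R) : continuous g ->
  measurable_fun [set: borelV R d] (g : borelV R d -> R).
Proof.
move=> cg; apply: (measurability _ (RGenOpens.measurableE R)) => _ [_ [a [c ->] <-]].
rewrite setTI; apply: sub_sigma_algebra.
by apply: open_comp => [x _|]; [exact: cg|exact: interval_open].
Qed.

(** An open set is the countable union of the cubes with rational centre and half-side 1/(n+1) that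
    it contains, and the preimage of a cube is a finite intersection of coordinate conditions. *)
Lemma measurable_borelV d d' (T : measurableType d') (f : T -> borelV R d) :
  (forall i, measurable_fun [set: T] (fun t => (f t : 'cV[R]_d) i 0)) ->
  measurable_fun [set: T] f.
Proof.
move=> mf; apply: (@measurability _ _ T (borelV R d) setT f (@open 'cV[R]_d)) => //.
move=> _ [A oA <-]; rewrite setTI.
pose box (p : 'cV[rat]_d * nat) : set 'cV[R]_d :=
  [set x | forall i, `|x i 0 - ratr (p.1 i 0)| < p.2.+1%:R^-1].
have boxE : f @^-1` A = \bigcup_p
    (if `[< box p `<=` A >] then f @^-1` box p else set0).
  apply/seteqP; split => [t /= At|t [p _]]; last by case: asboolP => // + tp; apply.
  have : nbhs (f t : 'cV[R]_d) A by exact: open_nbhs_nbhs.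
  move=> /nbhs_ballP[e /= e0 eA].
  (* The factor 2 pays for two distances, from [f t] to the rational centre and from there to any
     point of the cube. *)
  pose n := Num.truncn (2 / e).
  have ne : 2 * n.+1%:R^-1 < e.
    by rewrite ltr_pdivrMr// mulrC -ltr_pdivrMr// truncnS_gt.
  have exq i : exists q : rat, `|(f t : 'cV[R]_d) i 0 - ratr q| < n.+1%:R^-1.
    have : (f t : 'cV[R]_d) i 0 - n.+1%:R^-1 < (f t : 'cV[R]_d) i 0 + n.+1%:R^-1.
      by rewrite ltrBlDr -addrA ltrDl addr_gt0.
    move=> /rat_in_itvoo[q]; rewrite in_itv/= => /andP[q1 q2].
    by exists q; rewrite distrC ltr_distl q1 q2.
  have [q qP] := choice exq.
  exists (\col_i q i, n) => //; case: asboolP => [_ i /=|]; first by rewrite mxE.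
  case=> x xq; apply: eA; rewrite -ball_normE /=.
  apply: le_lt_trans ne; apply: mx_norm_le => [|i j]; first by rewrite mulr_ge0.
  rewrite ord1 !mxE mulr_natl mulr2n -[X in `|X|](subrKA (ratr (q i))).
  rewrite (le_trans (ler_normD _ _))// lerD ?ltW// distrC.
  by have := xq i; rewrite /= mxE.
rewrite boxE; apply: countable_bigcupT_measurable => // p.
case: asboolP => // _.
have -> : f @^-1` box p = \bigcap_(i in [set: 'I_d])
    ((fun t => (f t : 'cV[R]_d) i 0) @^-1` ball (ratr (p.1 i 0) : R) p.2.+1%:R^-1).
  apply/seteqP; split => t /= H i; last by rewrite distrC; exact: (H i Logic.I).
  by move=> _; rewrite /ball /= distrC.
apply: fin_bigcap_measurable => // i _.
rewrite -[X in measurable X]setTI; apply: mf => //; exact: measurable_ball.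
Qed.

Lemma lipschitz_entry_continuous d m n (f : 'cV[R]_d -> 'M[R]_(m, n)) i j :
  lipschitz_field f -> continuous (fun x => f x i j).
Proof.
move=> [L fL] x A /= /(nbhs_ballP (f x i j))[e0 /= e00 eA].
(* The square root of d compares the Frobenius norm with the max-entry norm of the topology; [L]
   carries no sign, hence its absolute value. *)
pose N := 1 + `|L| * Num.sqrt (d%:R * 1%:R).
have N0 : 0 < N by rewrite ltr_pwDl// mulr_ge0// sqrtr_ge0.
have [e [ee0 e_gt0]] : exists e, e < e0 /\ 0 < e.
  by exists (e0 / 2); rewrite ltr_pdivrMr// ltr_pMr// ltr1n divr_gt0.
apply/nbhs_ballP; exists (e / N) => /=; first exact: divr_gt0.
move=> y; rewrite -ball_normE /= => /ltW xy; apply: eA.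
rewrite -ball_normE /=; apply: le_lt_trans ee0.
have -> : f x i j - f y i j = (f x - f y) i j by rewrite !mxE.
apply: le_trans (entry_le_frob _ _ _) _; apply: le_trans (fL _ _) _.
have fxy : frob (x - y) <= Num.sqrt (d%:R * 1%:R) * (e / N).
  by apply: frob_le_bound => k l; rewrite (le_trans (entry_le_mx_norm _ _ _)).
apply: (@le_trans _ _ (`|L| * (Num.sqrt (d%:R * 1%:R) * (e / N)))).
  apply: (@le_trans _ _ (`|L| * frob (x - y))).
    by rewrite ler_wpM2r ?frob_ge0// ler_norm.
  by rewrite ler_wpM2l.
have -> : `|L| * (Num.sqrt (d%:R * 1%:R) * (e / N)) =
    e * (`|L| * Num.sqrt (d%:R * 1%:R) / N) by ring.
by rewrite ler_piMr ?(ltW e_gt0)// ler_pdivrMr// mul1r lerDr.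
Qed.

Lemma random_vectorP d' (O : measurableType d') (P : probability O R) n
    (X : O -> 'cV[R]_n) :
  random_vector X <-> measurable_fun [set: O] (X : O -> borelV R n).
Proof.
split=> [mX _ B mB|mX B mB]; first by rewrite setTI; exact: mX.
by rewrite -[X in measurable X]setTI; apply: mX.
Qed.

Section EulerStep.
Context {d r : nat} {b : 'cV[R]_d -> 'cV[R]_d} {sigma : 'cV[R]_d -> 'M[R]_(d, r)}.
Hypotheses (hb : lipschitz_field b) (hsigma : lipschitz_field sigma).
Context {d' : measure_display} {T : measurableType d'}.

Lemma measurable_euler_step (c : R) (X : T -> borelV R d) (W : T -> borelV R r) :
  measurable_fun setT X -> measurable_fun setT W ->
  measurable_fun setT (fun t => (X t : 'cV[R]_d) + c *: b (X t) +
    Num.sqrt c *: (sigma (X t) *m W t) : borelV R d).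
Proof.
move=> mX mW; apply: measurable_borelV => i.
have -> : (fun t => ((X t : 'cV[R]_d) + c *: b (X t) +
    Num.sqrt c *: (sigma (X t) *m W t)) i 0) =
    (fun t => (X t : 'cV[R]_d) i 0) \+ (fun t => c * b (X t) i 0) \+
    (fun t => Num.sqrt c * \sum_j sigma (X t) i j * (W t : 'cV[R]_r) j 0).
  by apply/funext => t /=; rewrite !mxE.
apply: measurable_funD; first apply: measurable_funD.
- by apply: (measurableT_comp (measurable_coord i)).
- apply: measurable_funM => //.
  apply: (measurableT_comp (f := fun x : borelV R d => b x i 0)) => //.
  by apply: continuous_measurable_borelV; exact: lipschitz_entry_continuous.
- apply: measurable_funM => //; apply: measurable_sum => j.
  apply: measurable_funM; last by apply: (measurableT_comp (measurable_coord j)).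
  apply: (measurableT_comp (f := fun x : borelV R d => sigma x i j)) => //.
  by apply: continuous_measurable_borelV; exact: lipschitz_entry_continuous.
Qed.

Lemma measurable_scheme (gamma : nat -> R) (X0 : T -> borelV R d)
    (U : nat -> T -> borelV R r) n :
  measurable_fun setT X0 ->
  (forall k, (1 <= k <= n)%N -> measurable_fun setT (U k)) ->
  measurable_fun setT (scheme b sigma gamma X0 U n : T -> borelV R d).
Proof.
move=> mX0; elim: n => [//|n IH mU] /=.
apply: measurable_euler_step; last by apply: mU; rewrite leqnn.
by apply: IH => k /andP[k1 kn]; apply: mU; rewrite k1 leqW.
Qed.

End EulerStep.
End Measurability.

(** * Independence and integration over the noise with the past frozen *)

Section Freezing.
Local Open Scope ereal_scope.
Context {R : realType} {d1 d2 : measure_display} {O : measurableType d1}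
  {T : measurableType d2} (P : probability O R).

(** For fixed [D], the restriction of [P] to [D] and [P] scaled by [P D] are finite measures that
    agree on the pi-system [G], hence on the sigma-algebra it generates. *)
Lemma pi_system_independence (G : set (set O)) (D : set O) :
  G `<=` measurable -> setI_closed G -> G setT -> measurable D -> 
  (forall E, G E -> P (E `&` D) = P E * P D) ->
  forall E, <<s G >> E -> P (E `&` D) = P E * P D.
Proof.
move=> Gm GI GT mD GD E GE.
have PDfin : P D \is a fin_num by exact: fin_num_measure.
have PD0 : (0 <= fine (P D))%R by rewrite fine_ge0.
have [c cE] : exists c : {nonneg R}, c%:num%:E = P D.
  by exists (NngNum PD0); exact: fineK.
suff H : forall E, <<s G >> E -> mrestr P mD E = mscale c P E.
  by rewrite -[P (E `&` D)]/(mrestr P mD E) H// /mscale cE muleC.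
apply: (g_sigma_algebra_measure_unique G Gm (fun=> setT)) => //.
- by rewrite bigcup_const.
- move=> A GA; change (P (A `&` D) = c%:num%:E * P A).
  by rewrite cE GD// muleC.
- move=> _; change (P (setT `&` D) < +oo).
  by rewrite setTI (le_lt_trans (probability_le1 P mD))// ltry.
Qed.

(** By independence the law of [(Z, Y)] is a product measure, and Tonelli's theorem applies. [Y'] is
    a copy of [Y] in law: the moment and concentration hypotheses are stated for [U 1] only. *)
Lemma integral_freezing d3 (O' : measurableType d3) (Z : O -> O') (Y Y' : O -> T)
    (f : O' * T -> \bar R) :
  measurable_fun setT Z -> measurable_fun setT Y -> measurable_fun setT Y' ->
  (forall B, measurable B -> P (Y @^-1` B) = P (Y' @^-1` B)) ->
  (forall A B, measurable A -> measurable B ->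
     P (Z @^-1` A `&` Y @^-1` B) = P (Z @^-1` A) * P (Y @^-1` B)) ->
  measurable_fun setT f -> (forall z, 0 <= f z) ->
  \int[P]_w f (Z w, Y w) = \int[P]_w \int[P]_w' f (Z w, Y' w').
Proof.
move=> mZ mY mY' YY' ind mf f0.
pose Zf : {mfun O >-> O'} := HB.pack Z (isMeasurableFun.Build _ _ _ _ Z mZ).
pose Yf : {mfun O >-> T} := HB.pack Y' (isMeasurableFun.Build _ _ _ _ Y' mY').
have mpair : measurable_fun setT (fun w => (Z w, Y w)).
  exact: measurable_fun_pair.
have law X : measurable X ->
    (distribution P Zf \x distribution P Yf) X = pushforward P (fun w => (Z w, Y w)) X.
  move=> mX; apply: product_measure_unique => // A B mA mB.
  change (P (Z @^-1` A `&` Y @^-1` B) = P (Z @^-1` A) * P (Y' @^-1` B)).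
  by rewrite -YY'// ind.
transitivity (\int[pushforward P (fun w => (Z w, Y w))]_z f z).
  by rewrite ge0_integral_pushforward.
rewrite (eq_measure_integral (distribution P Zf \x distribution P Yf)); last first.
  by move=> A mA _; exact/esym/law.
rewrite fubini_tonelli1// ge0_integral_distribution//=; last 2 first.
- exact: measurable_fun_fubini_tonelli_F.
- by move=> x; apply: integral_ge0.
apply: eq_integral => w _; rewrite /fubini_F ge0_integral_distribution//.
exact: measurableT_comp.
Qed.

Lemma le_integral_freezing d3 (O' : measurableType d3) (Z : O -> O')
    (Y Y' : O -> T) (f : O' * T -> \bar R) (h : O -> \bar R) :
  measurable_fun setT Z -> measurable_fun setT Y -> measurable_fun setT Y' ->
  (forall B, measurable B -> P (Y @^-1` B) = P (Y' @^-1` B)) ->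
  (forall A B, measurable A -> measurable B ->
     P (Z @^-1` A `&` Y @^-1` B) = P (Z @^-1` A) * P (Y @^-1` B)) ->
  measurable_fun setT f -> (forall z, 0 <= f z) ->
  measurable_fun setT h -> (forall w, \int[P]_w' f (Z w, Y' w') <= h w) ->
  \int[P]_w f (Z w, Y w) <= \int[P]_w h w.
Proof.
move=> mZ mY mY' YY' ind mf f0 mh fh.
rewrite (integral_freezing mZ mY mY')//; apply: ge0_le_integral => //.
  by move=> w _; exact: integral_ge0.
pose Yf : {mfun O >-> T} := HB.pack Y' (isMeasurableFun.Build _ _ _ _ Y' mY').
have -> : (fun w => \int[P]_w' f (Z w, Y' w')) =
    fubini_F (distribution P Yf) f \o Z.
  apply/funext => w; rewrite /= /fubini_F ge0_integral_distribution//.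
  exact: measurableT_comp.
by apply: measurableT_comp mZ; exact: measurable_fun_fubini_tonelli_F.
Qed.

End Freezing.

(** * One step of the scheme *)

Section OneStep.
Context {R : realType} {d r : nat} {dO : measure_display} {O : measurableType dO}
  (P : probability O R).

(** The finite values of the moments force integrability, which linearity of the integral requires;
    the squared norm then has mean [r]. *)
Lemma integral_quadratic (W : O -> 'cV[R]_r) (c0 e : R) (c : 'I_r -> R) :
  (forall i, measurable_fun setT (fun w => W w i 0)) ->
  (forall i, 'E_P[fun w => W w i 0%R] = 0)%E ->
  (forall i j, 'E_P[fun w => (W w i 0 * W w j 0)%R] = (i == j)%:R%:E)%E ->
  (\int[P]_w (c0 + (\sum_i c i * W w i 0) + e * frob (W w) ^+ 2)%:E =
    (c0 + e * r%:R)%:E)%E.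
Proof.
move=> mW W1 W2.
have fin_integrable (f : O -> R) (z : R) : measurable_fun setT f ->
    (\int[P]_w (f w)%:E = z%:E)%E -> P.-integrable setT (EFin \o f).
  move=> mf fE; apply/integrableP; split; first exact/measurable_EFinP.
  by rewrite -[X in (X < _)%E]/(\int[P]_w `|(f w)%:E|)%E integral_fin_num_abs// fE.
have {}W1 i : (\int[P]_w (W w i 0)%:E = 0)%E by have := W1 i; rewrite unlock.
have {}W2 i : (\int[P]_w (W w i 0 * W w i 0)%:E = 1)%E.
  by have := W2 i i; rewrite unlock eqxx.
have i1 i := fin_integrable _ _ (mW i) (W1 i).
have i2 i := fin_integrable _ _ (measurable_funM (mW i) (mW i)) (W2 i).
pose h i w := ((c i)%:E * (W w i 0)%:E + e%:E * (W w i 0 * W w i 0)%:E)%E.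
have ih i : P.-integrable setT (h i).
  by apply: integrableD => //; apply: integrableZl => //; [exact: i1|exact: i2].
have hE i : (\int[P]_w h i w = e%:E)%E.
  rewrite /h integralD//; [|apply: integrableZl => //; exact: i1
    |apply: integrableZl => //; exact: i2].
  rewrite integralZl//; last exact: i1.
  rewrite integralZl//; last exact: i2.
  by rewrite W1 W2 mule0 add0e mule1.
transitivity (\int[P]_w (c0%:E + \sum_i h i w))%E.
  apply: eq_integral => w _; rewrite /h -addrA EFinD; congr (_ + _)%E.
  rewrite -EFin_sum_fine; last by move=> i _.
  congr (_%:E); rewrite frob_sqr_col mulr_sumr -big_split.
  by apply: eq_bigr => i _ /=; rewrite expr2.
have ic : P.-integrable setT (fun=> c0%:E).
  exact: finite_measure_integrable_cst.
rewrite integralD//; last exact: integrable_sum.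
have -> : (\int[P]_w c0%:E = c0%:E)%E.
  rewrite (integral_cst P measurableT c0%:E) [X in (_ * X)%E](_ : _ = 1%E) ?mule1//.
  exact: probability_setT.
rewrite integral_sum// (eq_bigr _ (fun i _ => hE i)).
by rewrite sumEFin sumr_const card_ord EFinD mulr_natr.
Qed.

Context (b : 'cV[R]_d -> 'cV[R]_d) (sigma : 'cV[R]_d -> 'M[R]_(d, r))
  (V : 'cV[R]_d -> R) (vstar CV alphaV betaV S H : R).
Hypotheses (hLV : lyapunov b sigma V vstar CV alphaV betaV)
  (hS : forall x, frob (sigma x) <= S) (S0 : 0 < S)
  (hH : forall x, frob (hess V x) <= H) (H0 : 0 < H).

Let step (g : R) x u : 'cV[R]_d := x + g *: b x + Num.sqrt g *: (sigma x *m u).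

Let V_gt0 x : 0 < V x.
Proof. by case: hLV => -[v0 vV] _ _ _; exact: lt_le_trans (vV x). Qed.

(** Three sources: the Lyapunov constant, the second-order part of the generator, and the mean of
    the term quadratic in the noise. *)
Let K1 := betaV + S ^+ 2 * H + H * S ^+ 2 * r%:R.

(** The coefficient of the noise in the second-order bound on [V]: the gradient term together with
    the cross term of the squared increment. *)
Let slope (g : R) x : 'cV[R]_r :=
  Num.sqrt g *: ((sigma x)^T *m (grad V x + (2 * H * g) *: b x)).

(* Half of the drift absorbs the term H g^2 |b|^2: this is the step condition. *)
Lemma lyapunov_step_le (g : R) x u : 0 < g -> g <= alphaV / (2 * CV * H) ->
  V (step g x u) <= V x + g * (- (alphaV / 2) * V x + betaV + S ^+ 2 * H) +
    dotp (slope g x) u + H * g * S ^+ 2 * frob u ^+ 2.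
Proof.
move=> g0 gle; have [_ [VC _ _] [CV0 CVle] [a0 b0 gen]] := hLV.
rewrite /step -addrA; apply: le_trans (second_order_bound _ _ VC hH) _.
set h := g *: b x + _; rewrite -!addrA lerD2l.
pose s := Num.sqrt g; have ss : s * s = g by rewrite -expr2 sqr_sqrtr// ltW.
have hE : dotp (grad V x) h + H * frob h ^+ 2 =
    g * dotp (b x) (grad V x) + H * g ^+ 2 * frob (b x) ^+ 2 + dotp (slope g x) u +
    H * g * frob (sigma x *m u) ^+ 2.
  have -> : frob h ^+ 2 = g ^+ 2 * frob (b x) ^+ 2 +
      2 * g * s * dotp (b x) (sigma x *m u) + g * frob (sigma x *m u) ^+ 2.
    rewrite !frob_sqr_dotp /h dotpDr 2![dotp (_ + _) _]dotpC !dotpDr !dotpZr.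
    rewrite 4![dotp (_ *: _) _]dotpC !dotpZr [dotp (sigma x *m u) (b x)]dotpC -/s.
    by rewrite -ss; ring.
  have -> : dotp (slope g x) u = s * (dotp (grad V x) (sigma x *m u) +
      2 * H * g * dotp (b x) (sigma x *m u)).
    rewrite /slope dotpC dotpZr dotpC -/s; congr (_ * _).
    rewrite dotpE trmx_mul trmxK -mulmxA -dotpE dotpC dotpDr dotpZr.
    by rewrite dotpC [dotp _ (b x)]dotpC.
  by rewrite /h dotpDr !dotpZr [dotp (grad V x) (b x)]dotpC -/s; ring.
rewrite hE.
have trle : `|\tr ((sigma x *m (sigma x)^T) *m hess V x)| <= S ^+ 2 * H.
  apply: le_trans (mxtrace_mul_le _ _) _; apply: ler_pM; rewrite ?frob_ge0//.
  apply: le_trans (frob_mulmx _ _) _; rewrite frob_tr expr2.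
  by apply: ler_pM; rewrite ?frob_ge0.
(* The Lyapunov inequality concerns the whole generator; its trace part is moved to the right and
   bounded. *)
have bgrad : dotp (b x) (grad V x) <= - alphaV * V x + betaV + S ^+ 2 * H.
  have := gen x; rewrite /generator => genx.
  have : - \tr ((sigma x *m (sigma x)^T) *m hess V x) <= S ^+ 2 * H.
    by apply: le_trans trle; rewrite -normrN ler_norm.
  have SH0 : 0 <= S ^+ 2 * H by rewrite mulr_ge0 ?sqr_ge0 ?ltW.
  lra.
have bb : H * g ^+ 2 * frob (b x) ^+ 2 <= g * (alphaV / 2 * V x).
  have b2 : frob (b x) ^+ 2 <= CV * V x.
    by apply: le_trans (CVle x); rewrite lerDr sqr_ge0.
  apply: (@le_trans _ _ (H * g ^+ 2 * (CV * V x))).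
    by rewrite ler_wpM2l// mulr_ge0 ?sqr_ge0 ?ltW.
  have : g * (2 * CV * H) <= alphaV by rewrite -ler_pdivlMr// !mulr_gt0.
  move=> gle'; have -> : H * g ^+ 2 * (CV * V x) = g * V x * (g * (2 * CV * H)) / 2.
    by field.
  have -> : g * (alphaV / 2 * V x) = g * V x * alphaV / 2 by ring.
  by rewrite ler_pM2r ?invr_gt0// ler_wpM2l// mulr_ge0 ?(ltW g0) ?(ltW (V_gt0 x)).
have su : H * g * frob (sigma x *m u) ^+ 2 <= H * g * S ^+ 2 * frob u ^+ 2.
  rewrite -[leRHS]mulrA ler_wpM2l ?mulr_ge0 ?(ltW H0) ?(ltW g0)//.
  rewrite -exprMn ler_pXn2r ?nnegrE ?mulr_ge0 ?frob_ge0 ?(ltW S0)//.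
  by apply: le_trans (frob_mulmx _ _) _; rewrite ler_wpM2r ?frob_ge0.
have gb : g * dotp (b x) (grad V x) <= g * (- alphaV * V x + betaV + S ^+ 2 * H).
  by rewrite ler_wpM2l ?(ltW g0).
have E : g * (- (alphaV / 2) * V x + betaV + S ^+ 2 * H) =
  g * (- alphaV * V x + betaV + S ^+ 2 * H) + g * (alphaV / 2 * V x) by field.
move: hE bb su gb E; lra.
Qed.

(** The gap is a square, (sqrt v - sqrt y)^2 / (2 sqrt v). *)
Lemma sqrt_le_tangent (v y : R) : 0 < v -> 0 <= y ->
  Num.sqrt y <= Num.sqrt v + (y - v) / (2 * Num.sqrt v).
Proof.
move=> v0 y0; have sv : 0 < Num.sqrt v by rewrite sqrtr_gt0.
have vE : v = Num.sqrt v ^+ 2 by rewrite sqr_sqrtr// ltW.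
have yE : y = Num.sqrt y ^+ 2 by rewrite sqr_sqrtr.
rewrite -subr_ge0; have -> : Num.sqrt v + (y - v) / (2 * Num.sqrt v) - Num.sqrt y =
    (Num.sqrt v - Num.sqrt y) ^+ 2 / (2 * Num.sqrt v).
  by rewrite {2}vE {1}yE; field; rewrite gt_eqF.
by rewrite divr_ge0 ?sqr_ge0// mulr_ge0 ?ltW.
Qed.

(* The tangent line of the square root reduces the mean of sqrt(V) after one step
   to the first two moments of the noise. *)
Lemma exp_sqrt_lyapunov_step (X0 : O -> 'cV[R]_d) (U : nat -> O -> 'cV[R]_r)
    (g lambda : R) x :
  lipschitz_field b -> lipschitz_field sigma ->
  random_vector (U 1%N) -> gaussian_concentration P X0 U ->
  0 < g -> g <= alphaV / (2 * CV * H) -> 1 <= lambda ->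
  (\int[P]_w (expR (lambda * Num.sqrt (V (step g x (U 1%N w)))))%:E <=
   (expR (lambda * ((1 - alphaV / 4 * g) * Num.sqrt (V x)) +
      (K1 / (2 * Num.sqrt vstar) + CV * S ^+ 2 / 2) * lambda ^+ 2 * g))%:E)%E.
Proof.
move=> hb hsigma mU hGC g0 gle l1.
have [[v0 vV] [VC _ _] [CV0 CVle] [a0 b0 gen]] := hLV.
have H_ge0 := ltW H0; have S2_ge0 := sqr_ge0 S.
have K1_ge0 : 0 <= K1.
  rewrite /K1; apply: addr_ge0; first by apply: addr_ge0 => //; exact: mulr_ge0.
  by apply: mulr_ge0; [exact: mulr_ge0|exact: ler0n].
have [_ U1 U2 _ GC] := hGC.
have mUc i : measurable_fun setT (fun w => U 1%N w i 0).
  have /(random_vectorP P) mU' := mU.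
  by apply: (measurableT_comp (measurable_coord i) mU').
(* A Lipschitz constant, in the noise, of sqrt(V) after the step: [Num.sqrt CV] for sqrt(V), the
   rest for the map from noise to position. Its square carries the factor [g] of the variance
   term. *)
pose ell := Num.sqrt CV * (Num.sqrt g * S).
have ell0 : 0 < ell by rewrite !mulr_gt0// sqrtr_gt0.
pose G (u : 'cV[R]_r) := Num.sqrt (V (step g x u)) / ell.
have GL u u' : `|G u - G u'| <= frob (u - u').
  rewrite /G -mulrBl normrM (gtr0_norm (_ : 0 < ell^-1)) ?invr_gt0//.
  rewrite ler_pdivrMr//.
  apply: le_trans (sqrt_lipschitz _ _ (ltW CV0) _ V_gt0 _) _.
  - exact: class_C_le VC.
  - by move=> z; apply: le_trans (CVle z); rewrite lerDl sqr_ge0.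
  have -> : step g x u - step g x u' = Num.sqrt g *: (sigma x *m (u - u')).
    by rewrite /step opprD addrACA subrr add0r mulmxBr scalerBr.
  rewrite frobZ (ger0_norm (sqrtr_ge0 _)) [leRHS]mulrC /ell -!mulrA.
  rewrite ler_wpM2l ?sqrtr_ge0// ler_wpM2l ?sqrtr_ge0//.
  by apply: le_trans (frob_mulmx _ _) _; rewrite ler_wpM2r ?frob_ge0.
have := GC G (lambda * ell) GL (mulr_gt0 (lt_le_trans ltr01 l1) ell0).
rewrite unlock => GCG; apply: le_trans (le_trans _ GCG) _.
  by under [in X in (_ <= X)%E]eq_integral do rewrite /G mulrA mulrAC (mulfK (lt0r_neq0 ell0)).
rewrite lee_fin ler_expR.
set m := ((1 - alphaV / 4 * g) * Num.sqrt (V x) + K1 / (2 * Num.sqrt vstar) * g).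
suff Em : fine (\int[P]_w (G (U 1%N w))%:E) <= m / ell.
  apply: (@le_trans _ _ (lambda * ell * (m / ell) + (lambda * ell) ^+ 2 / 2)).
    by rewrite lerD2r ler_wpM2l// mulr_ge0 ?ltW// (lt_le_trans ltr01).
  have -> : lambda * ell * (m / ell) = lambda * m by field; rewrite gt_eqF.
  have -> : (lambda * ell) ^+ 2 = lambda ^+ 2 * (CV * g * S ^+ 2).
    by rewrite !exprMn !sqr_sqrtr ?(ltW g0) ?(ltW CV0)// -!mulrA.
  rewrite /m mulrDr -addrA lerD2l.
  have K10 : 0 <= K1 / (2 * Num.sqrt vstar) * g.
    by apply: mulr_ge0 (ltW g0); rewrite divr_ge0// mulr_ge0 ?sqrtr_ge0.
  (* Here [1 <= lambda] merges the drift constant with the variance term. *)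
  have l2 : lambda * (K1 / (2 * Num.sqrt vstar) * g) <=
      lambda ^+ 2 * (K1 / (2 * Num.sqrt vstar) * g).
    by rewrite ler_wpM2r// expr2 ler_peMl// (le_trans ler01).
  set k := K1 / _ in l2 *; lra.
have mG : measurable_fun setT (fun w => G (U 1%N w)).
  have /(random_vectorP P) mU' := mU.
  apply: measurable_funM => //; apply: measurableT_comp => //.
    by apply: continuous_measurable_fun; exact: sqrt_continuous.
  apply: (measurableT_comp (continuous_measurable_borelV (class_C_continuous VC))).
  by apply: measurable_euler_step => //.
have G0 w : 0 <= G (U 1%N w) by rewrite /G divr_ge0 ?sqrtr_ge0 ?ltW.
have sv : 0 < Num.sqrt (V x) by rewrite sqrtr_gt0.
pose q := slope g x.
pose D := 2 * Num.sqrt (V x) * ell.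
have D0 : 0 < D by apply: mulr_gt0 => //; exact: mulr_gt0.
pose c0 := Num.sqrt (V x) / ell +
  g * (- (alphaV / 2) * V x + betaV + S ^+ 2 * H) / D.
have Gle w : G (U 1%N w) <= c0 + \sum_i q i 0 / D * U 1%N w i 0 +
    H * g * S ^+ 2 / D * frob (U 1%N w) ^+ 2.
  have -> : \sum_i q i 0 / D * U 1%N w i 0 = dotp q (U 1%N w) / D.
    by rewrite /dotp mulr_suml; apply: eq_bigr => i _; rewrite mulrAC.
  have := sqrt_le_tangent (V_gt0 x) (ltW (V_gt0 (step g x (U 1%N w)))).
  have := lyapunov_step_le x (U 1%N w) g0 gle; rewrite -/q.
  set V' := V (step _ _ _) => A B; rewrite /G -/V' ler_pdivrMr//.
  apply: (le_trans B); have -> : (c0 + dotp q (U 1%N w) / D +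
      H * g * S ^+ 2 / D * frob (U 1%N w) ^+ 2) * ell =
      Num.sqrt (V x) + (g * (- (alphaV / 2) * V x + betaV + S ^+ 2 * H) +
       dotp q (U 1%N w) + H * g * S ^+ 2 * frob (U 1%N w) ^+ 2) / (2 * Num.sqrt (V x)).
    by rewrite /c0 /D; field; rewrite !gt_eqF.
  rewrite lerD2l ler_pM2r ?invr_gt0 ?mulr_gt0//; lra.
have mle : (\int[P]_w (G (U 1%N w))%:E <= (c0 + H * g * S ^+ 2 / D * r%:R)%:E)%E.
  rewrite -(integral_quadratic c0 _ (fun i => q i 0 / D) mUc U1 U2).
  apply: ge0_le_integral => //.
  - by move=> w _; rewrite lee_fin.
  - exact/measurable_EFinP.
  - apply/measurable_EFinP; apply: measurable_funD; first apply: measurable_funD => //.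
      by apply: measurable_sum => i; apply: measurable_funM.
    apply: measurable_funM => //; under eq_fun do rewrite frob_sqr_col.
    by apply: measurable_sum => i; apply: measurable_funX.
  - by move=> w _; rewrite lee_fin; exact: Gle.
have : fine (\int[P]_w (G (U 1%N w))%:E) <= c0 + H * g * S ^+ 2 / D * r%:R.
  have I0 : (0 <= \int[P]_w (G (U 1%N w))%:E)%E.
    by apply: integral_ge0 => w _; rewrite lee_fin.
  rewrite -[leRHS]/(fine (c0 + H * g * S ^+ 2 / D * r%:R)%:E) fine_le//.
  by rewrite ge0_fin_numE// (le_lt_trans mle)// ltry.
move=> /le_trans; apply; rewrite ler_pdivlMr//.
have -> : (c0 + H * g * S ^+ 2 / D * r%:R) * ell = Num.sqrt (V x) +
    g * (- (alphaV / 2) * V x + K1) / (2 * Num.sqrt (V x)).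
  by rewrite /c0 /D /K1; field; rewrite !gt_eqF.
(* Dividing the drift [alphaV / 2 * V x] by [2 * Num.sqrt (V x)] produces the rate [alphaV / 4] on
   sqrt(V); the remaining constant is then bounded through [vstar <= V x]. *)
have -> : Num.sqrt (V x) + g * (- (alphaV / 2) * V x + K1) / (2 * Num.sqrt (V x)) =
    (1 - alphaV / 4 * g) * Num.sqrt (V x) + K1 / (2 * Num.sqrt (V x)) * g.
  rewrite -[in - (alphaV / 2) * V x](sqr_sqrtr (ltW (V_gt0 x))).
  by field; rewrite gt_eqF.
rewrite /m lerD2l ler_wpM2r ?(ltW g0)//.
rewrite ler_wpM2l// lef_pV2 ?posrE ?mulr_gt0 ?sqrtr_gt0//.
by rewrite ler_wpM2l// ler_wsqrtr.
Qed.

End OneStep.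

(** * The sigma-algebra of the past *)

Section History.
Context {R : realType} {d r : nat} {dO : measure_display} {O : measurableType dO}
  (P : probability O R) (X0 : O -> 'cV[R]_d) (U : nat -> O -> 'cV[R]_r).
Hypotheses (hX0 : random_vector X0)
  (hU : forall k, (0 < k)%N -> random_vector (U k)) (hiid : iid_noise P X0 U).

(* A pi-system generating the sigma-algebra of X0, U_1, ..., U_n. *)
Definition history (n : nat) : set (set O) := [set E | exists A B,
  [/\ borel_set A, forall k, borel_set (B k) &
      E = X0 @^-1` A `&`
        \bigcap_(k in [set k | (1 <= k <= n)%N]) U k @^-1` B k]].

Let borel_setT m : borel_set [set: 'cV[R]_m].
Proof. exact: (@measurableT _ (borelV R m)). Qed.

Let borel_setI m (A B : set 'cV[R]_m) :
  borel_set A -> borel_set B -> borel_set (A `&` B).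
Proof. exact: (@measurableI _ (borelV R m)). Qed.

Lemma history_measurable n : history n `<=` measurable.
Proof.
move=> _ [A [B [mA mB ->]]]; apply: measurableI; first exact: hX0.
by apply: bigcap_measurableType => k /andP[k1 _]; exact: (hU k1 (mB k)).
Qed.

Lemma history_setI n : setI_closed (history n).
Proof.
move=> _ _ [A [B [mA mB ->]]] [A' [B' [mA' mB' ->]]].
exists (A `&` A'), (fun k => B k `&` B' k); split.
- exact: borel_setI.
- by move=> k; exact: borel_setI.
- apply/seteqP; split => w /=.
    by move=> [[wA wB] [wA' wB']]; split=> // k kn; split; [exact: wB|exact: wB'].
  by move=> [[wA wA'] wB]; do 2 split => //; move=> k kn; have [] := wB k kn.
Qed.

Lemma history_setT n : history n setT.
Proof.
exists setT, (fun=> setT); split=> [|k|]; [exact: borel_setT|exact: borel_setT|].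
by apply/seteqP; split.
Qed.

(** Putting [D] in slot [n.+1] turns the intersection into a cylinder of length [n.+1], whose
    probability has exactly one factor more. *)
Lemma history_independence n E D : history n E -> borel_set D ->
  (P (E `&` U n.+1 @^-1` D) = P E * P (U n.+1 @^-1` D))%E.
Proof.
move=> [A [B [mA mB ->]]] mD; have [ind _] := hiid.
pose B' k := if k == n.+1 then D else B k.
have B'D : B' n.+1 = D by rewrite /B' eqxx.
have mB' k : borel_set (B' k) by rewrite /B'; case: ifP.
have -> : X0 @^-1` A `&` \bigcap_(k in [set k | (1 <= k <= n)%N]) U k @^-1` B k
      `&` U n.+1 @^-1` D =
    X0 @^-1` A `&` \bigcap_(k in [set k | (1 <= k <= n.+1)%N]) U k @^-1` B' k.
  apply/seteqP; split => w /=.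
    move=> [[wA wB] wD]; split=> // k /= /andP[k1 kn]; rewrite /B' /=.
    case: eqVneq => [->//|kne]; apply: wB; rewrite /= k1/=.
    by rewrite -ltnS ltn_neqAle kne.
  move=> [wA wB]; split; last first.
    by have := wB n.+1; rewrite /= /B' eqxx; apply; rewrite /= leqnn.
  split=> // k /= /andP[k1 kn]; have := wB k; rewrite /= /B'.
  by rewrite ltn_eqF ?ltnS//; apply; rewrite k1 leqW.
rewrite !ind// big_nat_recr//= muleA B'D; congr (_ * _ * _)%E.
by apply: eq_big_nat => k /andP[_ kn]; rewrite /B' ltn_eqF.
Qed.

Lemma measurable_history_X0 n :
  measurable_fun setT (X0 : g_sigma_algebraType (history n) -> borelV R d).
Proof.
move=> _ A mA; rewrite setTI; apply: sub_sigma_algebra.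
exists A, (fun=> setT); split=> [//|_|]; first exact: borel_setT.
by apply/seteqP; split=> [w wA|w []//]; split.
Qed.

Lemma measurable_history_U n k : (1 <= k <= n)%N ->
  measurable_fun setT (U k : g_sigma_algebraType (history n) -> borelV R r).
Proof.
move=> kn _ D mD; rewrite setTI; apply: sub_sigma_algebra.
exists setT, (fun j => if j == k then D else setT); split=> [|j|].
- exact: borel_setT.
- by case: ifP => _ //; exact: borel_setT.
- apply/seteqP; split=> [w wD|w [_ /(_ k kn)]]; last by rewrite /= eqxx.
  by split=> // j _ /=; case: eqVneq => [->|].
Qed.

Lemma le_integral_next_noise n (f : g_sigma_algebraType (history n) * borelV R r -> \bar R)
    (h : O -> \bar R) :
  measurable_fun setT f -> (forall z, 0 <= f z)%E -> measurable_fun setT h ->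
  (forall w, \int[P]_w' f (w, U 1%N w') <= h w)%E ->
  (\int[P]_w f (w, U n.+1 w) <= \int[P]_w h w)%E.
Proof.
move=> mf f0 mh fh.
apply: (@le_integral_freezing _ _ _ _ (borelV R r) P _
  (g_sigma_algebraType (history n)) idfun (U n.+1) (U 1%N) f h) => //.
- move=> _ B mB; rewrite setTI.
  exact: (smallest_sub (@sigma_algebra_measurable _ O) (@history_measurable n) mB).
- exact/(random_vectorP P)/hU.
- exact/(random_vectorP P)/hU.
- by move=> B mB; apply: hiid.2.
- move=> A B mA mB; apply: (pi_system_independence (G := history n)) mA.
  + exact: history_measurable.
  + exact: history_setI.
  + exact: history_setT.
  + exact: hU.
  + by move=> E HE; exact: history_independence.
Qed.

End History.

(** * Exponential moments of the weighted sums *)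

Section ExponentialMoment.
Context {R : realType} {d r : nat} {dO : measure_display} {O : measurableType dO}
  (P : probability O R) (X0 : O -> 'cV[R]_d) (U : nat -> O -> 'cV[R]_r)
  (b : 'cV[R]_d -> 'cV[R]_d) (sigma : 'cV[R]_d -> 'M[R]_(d, r))
  (gamma : nat -> R).

Definition weighted_sum {T : Type} (F : 'cV[R]_d -> R) (X : nat -> T -> 'cV[R]_d)
    (n : nat) (w : T) : R :=
  \sum_(1 <= k < n.+1) gamma k * F (X k.-1 w).

Lemma weighted_sumE {T : Type} F (X : nat -> T -> 'cV[R]_d) n w :
  weighted_sum F X n w = \sum_(i < n) gamma i.+1 * F (X i w).
Proof. by rewrite /weighted_sum big_add1 big_mkord. Qed.

Hypotheses (hb : lipschitz_field b) (hsigma : lipschitz_field sigma).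

(** The sum of index [n] stops at [X (n - 1)]. Hence [n <= m.+1]: the sum of index [m.+1] is still
    determined by the first [m] noises. *)
Lemma measurable_weighted_sum d' (T : measurableType d') (Y0 : T -> borelV R d)
    (W : nat -> T -> borelV R r) (F : 'cV[R]_d -> R) n m :
  continuous F -> measurable_fun setT Y0 ->
  (forall k, (1 <= k <= m)%N -> measurable_fun setT (W k)) -> (n <= m.+1)%N ->
  measurable_fun setT (weighted_sum F (scheme b sigma gamma Y0 W) n).
Proof.
move=> cF mY0 mW nm.
have -> : weighted_sum F (scheme b sigma gamma Y0 W) n =
    (fun w => \sum_(i < n) gamma i.+1 * F (scheme b sigma gamma Y0 W i w)).
  by apply/funext => w; rewrite weighted_sumE.
apply: measurable_sum => i; apply: measurable_funM => //.
apply: (measurableT_comp (continuous_measurable_borelV cF)).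
apply: measurable_scheme => // k /andP[k1 ki]; apply: mW.
by rewrite k1 /= (leq_trans ki)// -ltnS (leq_trans (ltn_ord i)).
Qed.

Context (V : 'cV[R]_d -> R) (vstar CV alphaV betaV S H lambda0 : R).
Hypotheses (hLV : lyapunov b sigma V vstar CV alphaV betaV)
  (hS : forall x, frob (sigma x) <= S) (S0 : 0 < S)
  (hH : forall x, frob (hess V x) <= H) (H0 : 0 < H).
Hypotheses (hX0 : random_vector X0)
  (hU : forall k, (0 < k)%N -> random_vector (U k))
  (hGC : gaussian_concentration P X0 U).
Hypotheses (gamma_gt0 : forall k, (0 < k)%N -> 0 < gamma k)
  (gamma_le : forall k, (0 < k)%N -> gamma k <= alphaV / (2 * CV * H)).

Let X := scheme b sigma gamma X0 U.
Let sV x := Num.sqrt (V x).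

Let sV_continuous : continuous sV.
Proof.
have [_ [VC _ _] _ _] := hLV => x.
by apply: continuous_comp; [exact: (class_C_continuous VC)|exact: sqrt_continuous].
Qed.

Let mX0 : measurable_fun setT (X0 : O -> borelV R d).
Proof. exact/(random_vectorP P). Qed.

Let mU k : (0 < k)%N -> measurable_fun setT (U k : O -> borelV R r).
Proof. by move=> k0; apply/(random_vectorP P)/hU. Qed.

Let energy n w := alphaV / 4 * weighted_sum sV X n w + sV (X n w).

Let K1 := (betaV + S ^+ 2 * H + H * S ^+ 2 * r%:R) / (2 * Num.sqrt vstar) +
  CV * S ^+ 2 / 2.

Lemma measurable_energy n : measurable_fun setT (energy n).
Proof.
apply: measurable_funD.
  apply: measurable_funM => //; apply: (measurable_weighted_sum (m := n)) => //.
  by move=> k /andP[k1 _]; exact: mU.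
apply: (measurableT_comp (continuous_measurable_borelV sV_continuous)).
by apply: measurable_scheme => // k /andP[k1 _]; exact: mU.
Qed.

(** The new summand of the weighted sum depends on the past only and equals, with its weight
    [alphaV / 4], what sqrt(V) loses by contraction in the step. The two cancel exactly and
    [energy n] reappears. *)
Lemma exp_energy_step (lambda : R) n : 1 <= lambda ->
  (\int[P]_w (expR (lambda * energy n.+1 w))%:E <=
   (expR (K1 * lambda ^+ 2 * gamma n.+1))%:E *
     \int[P]_w (expR (lambda * energy n w))%:E)%E.
Proof.
move=> l1.
pose Z w := lambda * (alphaV / 4 * weighted_sum sV X n.+1 w).
pose f (z : g_sigma_algebraType (history X0 U n) * borelV R r) : \bar R :=
  (expR (Z z.1 + lambda * sV (X n z.1 + gamma n.+1 *: b (X n z.1) +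
     Num.sqrt (gamma n.+1) *: (sigma (X n z.1) *m (z.2 : 'cV[R]_r)))))%:E.
pose h w := (expR (K1 * lambda ^+ 2 * gamma n.+1) * expR (lambda * energy n w))%:E.
have mh : measurable_fun setT (fun w => (expR (lambda * energy n w))%:E).
  apply/measurable_EFinP; apply: measurableT_comp => //.
  by apply: measurable_funM => //; exact: measurable_energy.
have -> : ((expR (K1 * lambda ^+ 2 * gamma n.+1))%:E *
     \int[P]_w (expR (lambda * energy n w))%:E = \int[P]_w h w)%E.
  by rewrite -ge0_integralZl_EFin.
have -> : (\int[P]_w (expR (lambda * energy n.+1 w))%:E = \int[P]_w f (w, U n.+1 w))%E.
  by apply: eq_integral => w _; rewrite /f /Z /energy /= -mulrDr.
have hist0 := @measurable_history_X0 _ _ _ _ _ X0 U n.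
have histU := @measurable_history_U _ _ _ _ _ X0 U n.
have mXn : measurable_fun setT (X n : g_sigma_algebraType (history X0 U n) -> borelV R d).
  by apply: measurable_scheme => //; exact: histU.
have [hiid _ _ _ _] := hGC.
apply: (le_integral_next_noise hX0 hU hiid) => //.
- apply/measurable_EFinP; apply: measurableT_comp => //; apply: measurable_funD.
    apply: (measurableT_comp (f := Z : g_sigma_algebraType (history X0 U n) -> R)) => //.
    apply: measurable_funM => //; apply: measurable_funM => //.
    exact: (measurable_weighted_sum (m := n)).
  apply: measurable_funM => //.
  apply: (measurableT_comp (continuous_measurable_borelV sV_continuous)).
  apply: (@measurable_euler_step R d r b sigma hb hsigma _
    (g_sigma_algebraType (history X0 U n) * borelV R r)%type (gamma n.+1)
    (fun z => X n z.1) snd); last exact: measurable_snd.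
  exact: (measurableT_comp mXn measurable_fst).
- by move=> z; rewrite lee_fin expR_ge0.
- apply/measurable_EFinP; apply: measurable_funM => //.
  exact/measurable_EFinP.
move=> w; rewrite /f /=.
under eq_integral do rewrite expRD EFinM.
have mstep : measurable_fun setT (fun w' => (expR (lambda * sV (X n w +
    gamma n.+1 *: b (X n w) + Num.sqrt (gamma n.+1) *: (sigma (X n w) *m U 1%N w'))))%:E).
  apply/measurable_EFinP; apply: measurableT_comp => //.
  apply: measurable_funM => //.
  apply: (measurableT_comp (continuous_measurable_borelV sV_continuous)).
  apply: (@measurable_euler_step R d r b sigma hb hsigma _ O (gamma n.+1)
    (fun=> X n w) (U 1%N)); last exact: mU.
  exact: measurable_cst.
rewrite ge0_integralZl_EFin ?expR_ge0//.
have := exp_sqrt_lyapunov_step hLV hS S0 hH H0 (X n w) hb hsigma (hU (ltn0Sn 0))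
  hGC (gamma_gt0 (ltn0Sn n)) (gamma_le (ltn0Sn n)) l1.
move=> /(lee_wpmul2l (_ : 0 <= (expR (Z w))%:E)%E) => /(_ _)/le_trans; apply.
  by rewrite lee_fin expR_ge0.
rewrite -EFinM /h lee_fin -!expRD ler_expR le_eqVlt; apply/orP; left; apply/eqP.
rewrite /Z /energy !weighted_sumE big_ord_recr/= -/sV -/K1 -/(sV (X n w)).
by ring.
Qed.

Lemma exp_energy_le (lambda : R) n : 1 <= lambda ->
  (\int[P]_w (expR (lambda * energy n w))%:E <=
   (expR (K1 * lambda ^+ 2 * Gamma_sum gamma n))%:E *
     \int[P]_w (expR (lambda * sV (X0 w)))%:E)%E.
Proof.
move=> l1; elim: n => [|n IH].
  rewrite /Gamma_sum big_geq// mulr0 expR0 mul1e /energy.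
  by under eq_integral do rewrite weighted_sumE big_ord0 mulr0 add0r.
apply: (le_trans (exp_energy_step n l1)).
have e0 : (0 <= (expR (K1 * lambda ^+ 2 * gamma n.+1))%:E)%E.
  by rewrite lee_fin expR_ge0.
apply: (le_trans (lee_wpmul2l e0 IH)).
have -> : Gamma_sum gamma n.+1 = gamma n.+1 + Gamma_sum gamma n.
  by rewrite /Gamma_sum big_nat_recr//= addrC.
by rewrite muleA -EFinM -expRD -mulrDr.
Qed.

Hypotheses (hlambda0 : 0 < lambda0) (hC1 : exp_square_moment P lambda0 X0).

(** sqrt(V) grows at most linearly, so Young's inequality trades the linear exponent for a square
    whose exponential moment is finite by (C1). *)
Lemma exp_initial_energy_le : exists K0 : R, 0 <= K0 /\
  forall lambda, 1 <= lambda ->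
  (\int[P]_w (expR (lambda * sV (X0 w)))%:E <= (expR (K0 * lambda ^+ 2))%:E)%E.
Proof.
have [[v0 vV] [VC _ _] [CV0 CVle] _] := hLV.
pose q := lambda0 / 2; have q0 : 0 < q by rewrite divr_gt0.
have := hC1 (_ : q < lambda0); rewrite unlock => /(_ _) Mfin.
have {}Mfin := Mfin ltac:(by rewrite /q ltr_pdivrMr// ltr_pMr// ltr1n).
set M := (\int[P]_w _)%E in Mfin.
have M0 : (0 <= M)%E by apply: integral_ge0 => w _; rewrite lee_fin expR_ge0.
have ME : M = (fine M)%:E by rewrite fineK// ge0_fin_numE.
have fM0 : 0 <= fine M by exact: fine_ge0.
(* The value at the origin, the Young constant, and the moment itself through x <= exp x. *)
pose K0 := sV 0 + CV / (4 * q) + fine M.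
have sV0 : 0 <= sV 0 by exact: sqrtr_ge0.
exists K0; split.
  apply: addr_ge0 => //; apply: addr_ge0 => //.
  by rewrite divr_ge0 ?(ltW CV0)// mulr_ge0// ltW.
move=> lambda l1.
have l0 : 0 <= lambda by rewrite (le_trans ler01).
have l2 : lambda <= lambda ^+ 2 by rewrite expr2 ler_peMl.
have mexp : measurable_fun setT (fun w => (expR (q * frob (X0 w) ^+ 2))%:E).
  apply/measurable_EFinP; apply: measurableT_comp => //; apply: measurable_funM => //.
  under eq_fun do rewrite frob_sqr_col.
  apply: measurable_sum => i; apply: measurable_funX.
  exact: (measurableT_comp (measurable_coord i) mX0).
apply: (@le_trans _ _ ((expR (lambda * sV 0 + lambda ^+ 2 * (CV / (4 * q))))%:E * M)%E).
  have -> : ((expR (lambda * sV 0 + lambda ^+ 2 * (CV / (4 * q))))%:E * M =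
      \int[P]_w ((expR (lambda * sV 0 + lambda ^+ 2 * (CV / (4 * q))))%:E *
        (expR (q * frob (X0 w) ^+ 2))%:E))%E.
    by rewrite ge0_integralZl_EFin ?expR_ge0.
  apply: ge0_le_integral => //.
  - apply/measurable_EFinP; apply: measurableT_comp => //; apply: measurable_funM => //.
    exact: (measurableT_comp (continuous_measurable_borelV sV_continuous) mX0).
  - exact: measurable_funeM.
  move=> w _; rewrite -EFinM lee_fin -expRD ler_expR.
  have sVle : sV (X0 w) <= sV 0 + Num.sqrt CV * frob (X0 w).
    rewrite -lerBlDl (le_trans (ler_norm _))//.
    rewrite -[X in frob X]subr0; apply: sqrt_lipschitz (ltW CV0) _ _ _.
    - exact: class_C_le VC.
    - by move=> z; exact: lt_le_trans (vV z).
    - by move=> z; apply: le_trans (CVle z); rewrite lerDl sqr_ge0.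
  apply: (le_trans (ler_wpM2l l0 sVle)); rewrite mulrDr -addrA lerD2l.
  rewrite -subr_ge0.
  have -> : lambda ^+ 2 * (CV / (4 * q)) + q * frob (X0 w) ^+ 2 -
      lambda * (Num.sqrt CV * frob (X0 w)) =
      (lambda * Num.sqrt CV - 2 * q * frob (X0 w)) ^+ 2 / (4 * q).
    by rewrite -{1}(sqr_sqrtr (ltW CV0)); field; rewrite gt_eqF.
  by rewrite divr_ge0 ?sqr_ge0// mulr_ge0 ?ltW.
rewrite ME -EFinM lee_fin.
apply: (@le_trans _ _ (expR (lambda * sV 0 + lambda ^+ 2 * (CV / (4 * q))) * expR (fine M))).
  by rewrite ler_wpM2l ?expR_ge0// (le_trans _ (expR_ge1Dx _))// lerDr.
rewrite -expRD ler_expR /K0 [leRHS]mulrC 2!mulrDr.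
rewrite lerD//; first by rewrite lerD2r ler_wpM2r.
by rewrite ler_peMl// (le_trans l1).
Qed.

(** [energy] exceeds the weighted sum by a non-negative term. For n > 0, Gamma_n >= gamma_1 turns
    the initial factor into one of the same form, at the price [K0 / gamma 1]. *)
Lemma exp_weighted_sum_le : exists K : R, 0 < K /\
  forall lambda n, 1 <= lambda -> (0 < n)%N ->
  (\int[P]_w (expR (lambda * (alphaV / 4 * weighted_sum sV X n w)))%:E <=
   (expR (K * lambda ^+ 2 * Gamma_sum gamma n))%:E)%E.
Proof.
have [K0 [K00 HK0]] := exp_initial_energy_le.
have [_ _ _ [a0 _ _]] := hLV.
have g1 := gamma_gt0 (ltn0Sn 0).
exists (`|K1| + K0 / gamma 1%N + 1); split.
  by rewrite ltr_wpDl// addr_ge0 ?normr_ge0// divr_ge0// ltW.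
move=> lambda n l1 n0.
have Gn : gamma 1%N <= Gamma_sum gamma n.
  rewrite /Gamma_sum (big_ltn (_ : 1 < n.+1)%N)// lerDl big_nat_cond.
  by apply: sumr_ge0 => k /andP[/andP[k1 _] _]; rewrite ltW// gamma_gt0// (leq_trans _ k1).
have Gn0 : 0 < Gamma_sum gamma n by exact: lt_le_trans Gn.
apply: (@le_trans _ _ (\int[P]_w (expR (lambda * energy n w))%:E)%E).
  apply: ge0_le_integral => //.
  - apply/measurable_EFinP; apply: measurableT_comp => //; apply: measurable_funM => //.
    apply: measurable_funM => //; apply: (measurable_weighted_sum (m := n)) => //.
    by move=> k /andP[k1 _]; exact: mU.
  - apply/measurable_EFinP; apply: measurableT_comp => //.
    by apply: measurable_funM => //; exact: measurable_energy.
  move=> w _; rewrite lee_fin ler_expR ler_wpM2l ?(le_trans ler01)//.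
  by rewrite lerDl sqrtr_ge0.
apply: (le_trans (exp_energy_le n l1)).
have e0 : (0 <= (expR (K1 * lambda ^+ 2 * Gamma_sum gamma n))%:E)%E.
  by rewrite lee_fin expR_ge0.
apply: (le_trans (lee_wpmul2l e0 (HK0 _ l1))).
rewrite -EFinM lee_fin -expRD ler_expR.
have L0 : 0 <= lambda ^+ 2 * Gamma_sum gamma n by rewrite mulr_ge0 ?sqr_ge0// ltW.
have A : K1 * (lambda ^+ 2 * Gamma_sum gamma n) <= `|K1| * (lambda ^+ 2 * Gamma_sum gamma n).
  by rewrite ler_wpM2r// ler_norm.
have B : K0 * lambda ^+ 2 <= K0 / gamma 1%N * (lambda ^+ 2 * Gamma_sum gamma n).
  have -> : K0 / gamma 1%N * (lambda ^+ 2 * Gamma_sum gamma n) =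
    K0 * lambda ^+ 2 * (Gamma_sum gamma n / gamma 1%N) by field; rewrite gt_eqF.
  apply: ler_peMr; first by rewrite mulr_ge0 ?sqr_ge0.
  by rewrite lter_pdivlMr// mul1r.
have -> : (`|K1| + K0 / gamma 1%N + 1) * lambda ^+ 2 * Gamma_sum gamma n =
    `|K1| * (lambda ^+ 2 * Gamma_sum gamma n) +
    K0 / gamma 1%N * (lambda ^+ 2 * Gamma_sum gamma n) +
    lambda ^+ 2 * Gamma_sum gamma n by ring.
rewrite -[X in X + _ <= _]mulrA; apply: (le_trans (lerD A B)).
by rewrite lerDl.
Qed.

End ExponentialMoment.

(** * Growth and continuity of the generator applied to a test function *)

Section GeneratorBound.
Context {R : realType} {d r : nat} (b : 'cV[R]_d -> 'cV[R]_d)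
  (sigma : 'cV[R]_d -> 'M[R]_(d, r)) (V : 'cV[R]_d -> R)
  (vstar CV alphaV betaV S : R).
Hypotheses (hLV : lyapunov b sigma V vstar CV alphaV betaV)
  (hS : forall x, frob (sigma x) <= S).

Lemma generator_le_sqrt_lyapunov (beta : R) (phi : 'cV[R]_d -> R) :
  class_C_holder 3 beta phi ->
  exists M : R, 0 < M /\ forall x, `|generator b sigma phi x| <= M * Num.sqrt (V x).
Proof.
move=> [_ bnd _]; have [[v0 vV] _ [CV0 CVle] _] := hLV.
have /choice[M1 M1P] i : exists M, forall x, `|pderiv [:: i] phi x| <= M.
  by apply: bnd.
have /choice[M2 M2P] (p : 'I_d * 'I_d) :
    exists M, forall x, `|pderiv [:: p.1; p.2] phi x| <= M.
  by apply: bnd.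
pose B1 := \sum_i `|M1 i|; pose B2 := \sum_p `|M2 p|.
have B1P i x : `|pderiv [:: i] phi x| <= B1.
  apply: (le_trans (M1P i x)); apply: (le_trans (ler_norm _)).
  by rewrite /B1 (bigD1 i)//= lerDl sumr_ge0.
have B2P i j x : `|pderiv [:: i; j] phi x| <= B2.
  apply: (le_trans (M2P (i, j) x)); apply: (le_trans (ler_norm _)).
  by rewrite /B2 (bigD1 (i, j))//= lerDl sumr_ge0.
pose A1 := Num.sqrt (d%:R * 1%:R) * B1; pose A2 := Num.sqrt (d%:R * d%:R) * B2.
have A1P x : frob (grad phi x) <= A1.
  by apply: frob_le_bound => i j; rewrite mxE.
have A2P x : frob (hess phi x) <= A2.
  by apply: frob_le_bound => i j; rewrite mxE.
have A10 : 0 <= A1 by rewrite mulr_ge0 ?sqrtr_ge0 ?sumr_ge0.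
have A20 : 0 <= A2 by rewrite mulr_ge0 ?sqrtr_ge0 ?sumr_ge0.
have sv0 : 0 < Num.sqrt vstar by rewrite sqrtr_gt0.
have S2 : 0 <= S ^+ 2 by exact: sqr_ge0.
(* The bounded second-order term becomes a multiple of sqrt(V) because V >= [vstar]; the final 1
   makes [M] positive. *)
pose M := Num.sqrt CV * A1 + S ^+ 2 * A2 / Num.sqrt vstar + 1.
exists M; split.
  rewrite ltr_wpDl//; apply: addr_ge0; first by rewrite mulr_ge0 ?sqrtr_ge0.
  by apply: divr_ge0 (ltW sv0); exact: mulr_ge0.
move=> x; have sVx : Num.sqrt vstar <= Num.sqrt (V x) by exact: ler_wsqrtr.
have bx : frob (b x) <= Num.sqrt CV * Num.sqrt (V x).
  rewrite -sqrtrM ?(ltW CV0)// -[leLHS]ger0_norm ?frob_ge0// -sqrtr_sqr ler_wsqrtr//.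
  by apply: le_trans (CVle x); rewrite lerDr sqr_ge0.
have T1 : `|dotp (b x) (grad phi x)| <= Num.sqrt CV * A1 * Num.sqrt (V x).
  apply: (le_trans (dotp_le _ _)); rewrite mulrAC.
  by apply: ler_pM; rewrite ?frob_ge0.
have T2 : `|2^-1 * \tr ((sigma x *m (sigma x)^T) *m hess phi x)| <=
    S ^+ 2 * A2 / Num.sqrt vstar * Num.sqrt (V x).
  apply: (@le_trans _ _ (S ^+ 2 * A2)).
    rewrite normrM ger0_norm ?invr_ge0//.
    apply: (@le_trans _ _ `|\tr ((sigma x *m (sigma x)^T) *m hess phi x)|).
      by rewrite ler_piMl// invf_le1// ler1n.
    apply: (le_trans (mxtrace_mul_le _ _)); apply: ler_pM; rewrite ?frob_ge0//.
    apply: le_trans (frob_mulmx _ _) _; rewrite frob_tr expr2.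
    by apply: ler_pM; rewrite ?frob_ge0.
  rewrite -[leRHS]mulrA; apply: ler_peMr; first exact: mulr_ge0.
  by rewrite mulrC ler_pdivlMr// mul1r.
rewrite /generator; apply: (le_trans (ler_normD _ _)).
apply: (le_trans (lerD T1 T2)); rewrite -mulrDl ler_wpM2r ?sqrtr_ge0//.
by rewrite /M lerDl.
Qed.

Lemma sum_continuous (T : topologicalType) (I : Type) (s : seq I) (F : I -> T -> R) :
  (forall i, continuous (F i)) -> continuous (fun y => \sum_(i <- s) F i y).
Proof.
move=> cF; elim: s => [|i s IH].
  rewrite (_ : (fun y => _) = cst 0); first exact: cst_continuous.
  by apply/funext => y; rewrite big_nil.
rewrite (_ : (fun y => _) = F i \+ (fun y => \sum_(j <- s) F j y)).
  by move=> x; apply: continuousD; [exact: cF|exact: IH].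
by apply/funext => y; rewrite big_cons.
Qed.

Lemma continuous_generator (phi : 'cV[R]_d -> R) :
  lipschitz_field b -> lipschitz_field sigma -> class_C 2 phi ->
  continuous (generator b sigma phi).
Proof.
move=> hb hsigma [_ cphi].
rewrite (_ : generator b sigma phi =
    (fun y => \sum_i b y i 0 * pderiv [:: i] phi y) \+
    (fun y => 2^-1 * \sum_i \sum_j (\sum_k sigma y i k * sigma y j k) *
      pderiv [:: j; i] phi y)).
  move=> x; apply: continuousD.
    apply: sum_continuous => i {}x; apply: continuousM; last exact: cphi.
    exact: lipschitz_entry_continuous.
  apply: continuousM; first exact: cst_continuous.
  apply: sum_continuous => i; apply: sum_continuous => j {}x.
  apply: continuousM; last exact: cphi.
  apply: sum_continuous => l {}x.
  by apply: continuousM; exact: lipschitz_entry_continuous.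
apply/funext => y; congr (_ + _ * _); first by apply: eq_bigr => i _; rewrite mxE.
apply: eq_bigr => i _; rewrite mxE; apply: eq_bigr => j _; rewrite !mxE.
by congr (_ * _); apply: eq_bigr => l _; rewrite mxE.
Qed.

End GeneratorBound.

(** * Comparison of the rates and the deviation bound *)

(** The quotient of the two powers is u^(2/3), which exceeds 1/(D kappa) from u = (1/(D
    kappa))^(3/2) on. *)
Lemma powR43_le_sqr {R : realType} (D kappa : R) : 0 <= D -> 0 < kappa ->
  exists u0 : R, forall u, u0 <= u -> u `^ (4 / 3) / D <= kappa * u ^+ 2.
Proof.
(* For [D = 0], division by zero yields 0 and the left side vanishes; this covers a zero [sigma] or
   a constant solution of the Poisson equation. *)
move=> D0 k0; have [->|Dn0] := eqVneq D 0.
  by exists 0 => u u0; rewrite invr0 mulr0 mulr_ge0 ?sqr_ge0 ?ltW.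
have {Dn0}D0 : 0 < D by rewrite lt_def Dn0.
pose z := 1 / (D * kappa); have z0 : 0 < z by rewrite divr_gt0 ?mulr_gt0.
exists (z `^ (3 / 2)) => u u0.
have zu : 0 < u by apply: lt_le_trans u0; exact: powR_gt0.
have : z <= u `^ (2 / 3).
  have -> : z = (z `^ (3 / 2)) `^ (2 / 3).
    by rewrite -powRrM (_ : 3 / 2 * (2 / 3) = 1) ?powRr1 ?(ltW z0)//; field.
  by apply: ge0_ler_powR; rewrite ?nnegrE ?powR_ge0 ?(ltW zu)// divr_ge0.
have -> : u ^+ 2 = u `^ (4 / 3) * u `^ (2 / 3).
  rewrite -powRD; last by rewrite gt_eqF ?implybT.
  by rewrite (_ : 4 / 3 + 2 / 3 = 2%:R) ?powR_mulrn ?(ltW zu)//; field.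
move=> zle; rewrite ler_pdivrMr//.
apply: (@le_trans _ _ (u `^ (4 / 3) * (D * kappa * z))).
  by rewrite /z mul1r divff ?mulr1// gt_eqF// mulr_gt0.
have -> : kappa * (u `^ (4 / 3) * u `^ (2 / 3)) * D =
  u `^ (4 / 3) * (D * kappa * u `^ (2 / 3)) by ring.
by rewrite ler_wpM2l ?powR_ge0// ler_wpM2l// ltW// mulr_gt0.
Qed.

Lemma le_supnorm {R : realType} {d m n : nat} (f : 'cV[R]_d -> 'M[R]_(m, n)) x :
  bounded_field f -> frob (f x) <= supnorm f.
Proof. by move=> bf; apply: ub_le_sup => //; exists x. Qed.

Lemma chernoff_weighted_sum {R : realType} {dO : measure_display}
    {O : measurableType dO} (P : probability O R) (Y : O -> R) (c K lambda t : R) :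
  measurable_fun setT Y -> 0 < c -> 0 < lambda ->
  (\int[P]_w (expR (lambda * (c * Y w)))%:E <= (expR K)%:E)%E ->
  (P [set w | t <= Y w]%R <= (expR (K - lambda * (c * t)))%:E)%E.
Proof.
move=> mY c0 l0 YK.
have mcY : measurable_fun setT (fun w => c * Y w) by exact: measurable_funM.
pose Z : {mfun O >-> R} := HB.pack (fun w => c * Y w)
  (isMeasurableFun.Build _ _ _ _ (fun w => c * Y w) mcY).
have -> : [set w | t <= Y w] = [set w | c * t <= Z w].
  by apply/seteqP; split=> w /=; rewrite ler_pM2l.
apply: (le_trans (chernoff (P := P) Z (c * t) l0)).
rewrite expRD EFinM lee_wpmul2r ?lee_fin ?expR_ge0//.
rewrite /mmt_gen_fun unlock; apply: le_trans YK.
by rewrite le_eqVlt; apply/orP; left; apply/eqP/eq_integral => w _ /=; rewrite mulrC.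
Qed.

Theorem theorem6 (R : realType) (d r : nat) (hd : (0 < d)%N) (hr : (0 < r)%N)
  (dO : measure_display) (O : measurableType dO) (P : probability O R)
  (b : 'cV[R]_d -> 'cV[R]_d) (sigma : 'cV[R]_d -> 'M[R]_(d, r))
  (hb : lipschitz_field b) (hsigma : lipschitz_field sigma)
  (theta : R) (htheta : 0 < theta <= 1)
  (gamma : nat -> R) (hgamma : step_sequence theta gamma)
  (X0 : O -> 'cV[R]_d) (hX0 : random_vector X0)
  (hX0_L2 : square_integrable P X0)
  (U : nat -> O -> 'cV[R]_r)
  (hU : forall k, (0 < k)%N -> random_vector (U k))
  (lambda0 : R) (hlambda0 : 0 < lambda0)
  (hC1 : exp_square_moment P lambda0 X0)
  (hGC : gaussian_concentration P X0 U)
  (hC2 : bounded_field sigma)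
  (V : 'cV[R]_d -> R) (vstar CV alphaV betaV : R)
  (hLV : lyapunov b sigma V vstar CV alphaV betaV)
  (nu : probability (borelV R d) R) (hnu : unique_invariant b sigma nu)
  (K cbar : R) (hS : small_steps b V CV alphaV K cbar gamma)
  (beta : R) (hbeta : 0 < beta <= 1)
  (phi : 'cV[R]_d -> R) (hphi : T_beta b V beta phi)
  (vartheta : 'cV[R]_d -> R) (hvartheta : T_beta b V beta vartheta)
  (hpoisson : forall x, generator b sigma vartheta x =
     carre_sigma sigma phi x - (\int[nu]_y carre_sigma sigma phi y)%R)
  (htheta_beta : 1 / (2 + beta) < theta) :
  exists c C : nat -> R,
    [/\ forall n, (0 < n)%N -> 0 <= c n /\ 0 <= C n,
        \forall n \near \oo, c n <= c n.+1 /\ C n.+1 <= C n,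
        c @ \oo --> (1 : R) /\ C @ \oo --> (1 : R)
      & (* as a / sqrt Gamma_n tends to +oo *)
        \forall u \near +oo, forall (n : nat) (a : R),
          (0 < n)%N -> 0 < a -> a / Num.sqrt (Gamma_sum gamma n) = u ->
          (P [set w | a <= `| Num.sqrt (Gamma_sum gamma n) *
                 emp_mean gamma (scheme b sigma gamma X0 U) n
                   (generator b sigma phi) w |]%R
           <= (2 * C n *
               expR (- c n * (a `^ (4 / 3) * Gamma_sum gamma n `^ (1 / 3) /
                  (2 * supnorm sigma `^ (2 / 3) *
                   lip_cst vartheta `^ (2 / 3)))))%:E)%E].
Proof.
have [gamma_gt0 _ _] := hgamma.
have [K0 cbar0 _ steps] := hS.
have [_ [VC2 hessV _] [CV0 _] [alpha0 _ _]] := hLV.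
have gamma_le k : (0 < k)%N -> gamma k <= alphaV / (2 * CV * supnorm (hess V)).
  by move=> k0; have := steps k k0; rewrite le_min => /andP[].
have H0 : 0 < supnorm (hess V).
  rewrite lt_def (le_trans (frob_ge0 _) (le_supnorm 0 hessV)) andbT.
  (* If the Hessian of [V] vanished, the step bound would be a division by zero, that is 0, against
     the positivity of the first step. *)
  apply/eqP => H0; have := gamma_le 1%N isT.
  by rewrite H0 mulr0 invr0 mulr0 leNgt gamma_gt0.
(* The added 1 gives a positive bound even when [sigma] vanishes. *)
have sigmaS x : frob (sigma x) <= supnorm sigma + 1.
  by apply: (le_trans (le_supnorm x hC2)); rewrite lerDl.
have S0 : 0 < supnorm sigma + 1.
  by rewrite ltr_wpDl// (le_trans (frob_ge0 _) (le_supnorm 0 hC2)).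
have [phiC _ _] := hphi; have [phiC3 _ _] := phiC.
have [M [M0 genM]] := generator_le_sqrt_lyapunov hLV sigmaS phiC.
have [K1 [K10 momK]] := exp_weighted_sum_le hb hsigma hLV sigmaS S0
  (fun x => le_supnorm x hessV) H0 hX0 hU hGC gamma_gt0 gamma_le hlambda0 hC1.
pose c := alphaV / 4; have c0 : 0 < c by rewrite divr_gt0.
(* [lambda = eps * u] minimizes the Chernoff exponent K1 lambda^2 G - lambda c u G / M; the minimum
   is [- (kappa * u ^+ 2 * G)]. *)
pose eps := c / (2 * K1 * M); have eps0 : 0 < eps by rewrite divr_gt0 ?mulr_gt0.
pose kappa := c ^+ 2 / (4 * K1 * M ^+ 2).
have kappa0 : 0 < kappa by rewrite divr_gt0 ?exprn_gt0// !mulr_gt0// exprn_gt0.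
pose D := 2 * supnorm sigma `^ (2 / 3) * lip_cst vartheta `^ (2 / 3).
have D0 : 0 <= D by rewrite !mulr_ge0 ?powR_ge0.
have [u0 u0P] := powR43_le_sqr D0 kappa0.
exists (fun=> 1), (fun=> 1); split=> //.
- by apply: nearW.
- by split; exact: cvg_cst.
near=> u => n a n0 a0.
set G := Gamma_sum gamma n => uE.
have G0 : 0 < G.
  rewrite /G /Gamma_sum big_add1 big_mkord (bigD1 (Ordinal n0))//=.
  by rewrite ltr_pwDl ?gamma_gt0// sumr_ge0// => k _; rewrite ltW// gamma_gt0.
have sG0 : 0 < Num.sqrt G by rewrite sqrtr_gt0.
have aE : a = u * Num.sqrt G by rewrite -uE divfK// gt_eqF.
have ueps : eps^-1 <= u by near: u; exact/nbhs_pinfty_ge/num_real.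
have uu0 : u0 <= u by near: u; exact/nbhs_pinfty_ge/num_real.
have u_gt0 : 0 < u by apply: lt_le_trans ueps; rewrite invr_gt0.
have lambda1 : 1 <= eps * u by rewrite mulrC -ler_pdivrMr// mul1r.
pose X := scheme b sigma gamma X0 U.
pose Y := weighted_sum gamma (fun x => Num.sqrt (V x)) X n.
have mX0 : measurable_fun setT (X0 : O -> borelV R d) by exact/(random_vectorP P).
have mU k : (1 <= k <= n)%N -> measurable_fun setT (U k : O -> borelV R r).
  by move=> /andP[k0 _]; apply/(random_vectorP P)/hU.
have mY : measurable_fun setT Y.
  apply: (measurable_weighted_sum gamma hb hsigma (m := n)) => //.
  move=> x; apply: continuous_comp; first exact: (class_C_continuous VC2).
  exact: sqrt_continuous.
have mgen : measurable_fun setT (weighted_sum gamma (generator b sigma phi) X n).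
  apply: (measurable_weighted_sum gamma hb hsigma (m := n)) => //.
  by apply: continuous_generator => //; exact: class_C_le phiC3.
have emp_le w : `|emp_mean gamma X n (generator b sigma phi) w| <= G^-1 * (M * Y w).
  rewrite /emp_mean -/G normrM (gtr0_norm (_ : 0 < G^-1)) ?invr_gt0//.
  rewrite ler_wpM2l ?invr_ge0 ?(ltW G0)//.
  rewrite -[\sum_(1 <= k < n.+1) _]/(weighted_sum gamma (generator b sigma phi) X n w).
  rewrite /Y !weighted_sumE mulr_sumr (le_trans (ler_norm_sum _ _ _))// ler_sum// => i _.
  rewrite normrM gtr0_norm ?gamma_gt0// mulrCA ler_wpM2l// ltW// gamma_gt0//.
have ge_measurable (f : O -> R) t : measurable_fun setT f -> measurable [set w | t <= f w].
  move=> mf; have -> : [set w | t <= f w] = f @^-1` `[t, +oo[%classic.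
    by apply/seteqP; split=> w /=; rewrite in_itv/= andbT.
  by rewrite -[X in measurable X]setTI; apply: mf => //; exact: measurable_itv.
apply: (@le_trans _ _ (P [set w | u * G / M <= Y w]%R)).
  apply: le_measure; rewrite ?inE.
  - apply: ge_measurable; apply: measurableT_comp => //.
    by apply: measurable_funM => //; apply: measurable_funM.
  - exact: ge_measurable.
  move=> w /=; rewrite aE normrM (gtr0_norm sG0) mulrC ler_pM2l// => uw.
  have := le_trans uw (emp_le w).
  by rewrite mulrC ler_pdivlMr// ler_pdivrMr// [M * _]mulrC.
have := chernoff_weighted_sum (u * G / M) mY c0 (mulr_gt0 eps0 u_gt0)
  (momK _ n lambda1 n0).
move=> /le_trans; apply.
(* [Y] dominates the absolute value, so the one-sided estimate covers both tails with prefactor 1 <=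
   2. *)
rewrite lee_fin mulr1 mulN1r -[leLHS]mul1r ler_pM ?expR_ge0// ?ler1n//.
rewrite ler_expR -/G.
have -> : K1 * (eps * u) ^+ 2 * G - eps * u * (c * (u * G / M)) = - (kappa * u ^+ 2 * G).
  by rewrite /eps /kappa; field; rewrite !gt_eqF.
rewrite lerN2 -/D.
(* With a = u sqrt(G), the powers of G add up to 2/3 + 1/3 = 1. *)
have -> : a `^ (4 / 3) * G `^ (1 / 3) = u `^ (4 / 3) * G.
  rewrite aE powRM ?(ltW u_gt0) ?(ltW sG0)// -mulrA; congr (_ * _).
  rewrite -powR12_sqrt ?(ltW G0)// -powRrM -powRD; last by rewrite gt_eqF ?implybT.
  by rewrite (_ : 2^-1 * (4 / 3) + 1 / 3 = 1) ?powRr1 ?(ltW G0)//; field.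
by rewrite mulrAC ler_wpM2r ?(ltW G0)// u0P.
Unshelve. all: by end_near. Qed.
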